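(* There exists a polynomial $P_3$ such that for every mean-payoff game $G$ and every rational $\epsilon\ge0$, the least $\epsilon$-fixed point $\lambda^*$ of the negotiation function of $G$ has size $\lVert\lambda^*\rVert\le P_3(\lVert G\rVert+\lVert\epsilon\rVert)$.
   Context: A mean-payoff game $G$ consists of a finite set $\Pi$ of players, a finite directed graph $(V,E)$ in which every vertex has an outgoing edge, a partition $(V_i)_{i\in\Pi}$ of $V$, and reward functions $r_i:E\to\mathbb{Q}$; $\lVert G\rVert$ is the size of its encoding with rationals in binary. Plays are infinite paths; $\mu_i(\rho)=\liminf_n\frac1n\sum_{k<n}r_i(\rho_k\rho_{k+1})$. Strategies, strategy profiles and outcomes $\langle\bar\sigma\rangle$ are as usual; $\bar\sigma_{\|hv}$ denotes the profile after history $hv$ ($\sigma_{i\|hv}(h')=\sigma_i(hh')$), and $-i=\Pi\setminus\{i\}$. A requirement is a map $\lambda:V\to\mathbb{R}\cup\{\pm\infty\}$. A play $\rho$ is $\lambda$-consistent if $\mu_i(\rho_{\ge n})\ge\lambda(\rho_n)$ for all $n$ and $i$ with $\rho_n\in V_i$. A profile $\bar\sigma_{-i}$ from $v$ is $\lambda$-rational if there is a strategy $\sigma_i$ such that for every history $hw$ from $v$ compatible with $\bar\sigma_{-i}$, the play $\langle\bar\sigma_{\|hw}\rangle$ is $\lambda$-consistent; $\lambda\mathsf{Rat}(v)$ is the set of such profiles. The negotiation function maps $\lambda$ to $\mathsf{nego}(\lambda)$ with $\mathsf{nego}(\lambda)(v)=\inf_{\bar\sigma_{-i}\in\lambda\mathsf{Rat}(v)}\sup_{\sigma_i}\mu_i(\langle\bar\sigma\rangle)$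 for $v\in V_i$ (with $\inf\emptyset=+\infty$). A requirement $\lambda$ is an $\epsilon$-fixed point of $\mathsf{nego}$ if $\mathsf{nego}(\lambda)(v)\in[\lambda(v)-\epsilon,\lambda(v)+\epsilon]$ for all $v$; a least $\epsilon$-fixed point (for the pointwise order) exists. Size: $\lVert p/q\rVert=1+\lceil\log_2(|p|+1)\rceil+\lceil\log_2(|q|+1)\rceil$ for coprime integers, $\lVert\pm\infty\rVert=1$, irrationals have size $+\infty$, and the size of $\lambda$ is $\mathsf{card}\,V+\sum_v\lVert\lambda(v)\rVert$. *)

(* Defs.v *)
From HB Require Import structures.
From mathcomp Require Import all_boot all_order all_algebra.
From mathcomp Require Import boolp classical_sets reals ereal sequences Rstruct.

Set Implicit Arguments.
Unset Strict Implicit.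
Unset Printing Implicit Defensive.

Import Order.TTheory GRing.Theory Num.Theory.
Local Open Scope classical_set_scope.
Local Open Scope ring_scope.

Notation R := Rdefinitions.R.

(** Mean-payoff game: players, vertices, edge relation (every vertex has an
    outgoing edge), the partition (V_i) given by the owner map, and rational
    rewards r_i (only their values on edges matter). *)
Record mpgame := MPGame {
  player : finType;
  vertex : finType;
  edge : rel vertex;
  owner : vertex -> player;
  reward : player -> vertex -> vertex -> rat;
  edge_total : forall v, exists w, edge v w }.

Definition size_rat (q : rat) : nat :=
  (1 + up_log 2 (`|numq q|%N + 1) + up_log 2 (`|denq q|%N + 1))%N.

Definition game_size (G : mpgame) : nat :=
  (#|player G| + #|vertex G| + #|[set e : vertex G * vertex G | edge e.1 e.2]|
   + \sum_(i : player G) \sum_(u : vertex G) \sum_(w : vertex G | edge u w)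
        size_rat (reward i u w))%N.

Section Game.
Variable G : mpgame.
Local Notation V := (vertex G).
Local Notation Pl := (player G).

(** Strategy of a player: maps a history (a nonempty sequence of vertices,
    whose last element is the current vertex) to a successor. *)
Definition strat := seq V -> V.
Definition profile := Pl -> strat.

Definition is_strat (i : Pl) (s : strat) : Prop :=
  forall (h : seq V) (v : V), owner v = i -> edge v (s (rcons h v)).

Definition mean_payoff (i : Pl) (rho : nat -> V) : \bar R :=
  limn_einf (fun n : nat =>
    (((\sum_(k < n) ratr (reward i (rho k) (rho k.+1))) / n%:R)%R : R)%:E).

(** Outcome of the profile after history [rcons h v] (i.e. of sigma_{|hv}):
    [run sigma h v n] is the list of the first n+1 vertices starting at v. *)
Fixpoint run (sigma : profile) (h : seq V) (v : V) (n : nat) : seq V :=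
  match n with
  | 0 => [:: v]
  | n'.+1 => let s := run sigma h v n' in
             rcons s (sigma (owner (last v s)) (h ++ s))
  end.

Definition outcome (sigma : profile) (h : seq V) (v : V) : nat -> V :=
  fun n => last v (run sigma h v n).

Definition requirement := V -> \bar R.

Local Open Scope ereal_scope.

Definition lam_consistent (lam : requirement) (rho : nat -> V) : Prop :=
  forall n : nat, lam (rho n) <= mean_payoff (owner (rho n)) (fun k => rho (n + k)%N).

Definition upd (tau : profile) (i : Pl) (s : strat) : profile :=
  fun j => if j == i then s else tau j.

Definition compat (tau : profile) (i : Pl) (v : V) (s : seq V) : Prop :=
  exists s', s = v :: s' /\ path (@edge G) v s' /\
    forall k : nat, (k.+1 < size s)%N -> owner (nth v s k) != i ->
      nth v s k.+1 = tau (owner (nth v s k)) (take k.+1 s).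

(** lambda-rational profiles sigma_{-i} from v (i the owner of v); a partial
    profile sigma_{-i} is represented by a full profile whose i-th component
    is ignored. *)
Definition lam_rat (lam : requirement) (v : V) (tau : profile) : Prop :=
  (forall j, j != owner v -> is_strat j (tau j)) /\
  exists s : strat, is_strat (owner v) s /\
    forall (h : seq V) (w : V), compat tau (owner v) v (rcons h w) ->
      lam_consistent lam (outcome (upd tau (owner v) s) h w).

Definition nego (lam : requirement) : requirement := fun v =>
  ereal_inf [set ereal_sup [set mean_payoff (owner v)
                               (outcome (upd tau (owner v) s) [::] v)
                            | s in is_strat (owner v)]
            | tau in lam_rat lam v].

Definition eps_fixed_point (eps : rat) (lam : requirement) : Prop :=
  forall v, lam v - (ratr eps : R)%:E <= nego lam v <= lam v + (ratr eps : R)%:E.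

Definition least_eps_fixed_point (eps : rat) (lam : requirement) : Prop :=
  eps_fixed_point eps lam /\
  forall lam', eps_fixed_point eps lam' -> forall v, lam v <= lam' v.

(** [ext_size x n]: the extended real x has (finite) size n; irrationals have
    no finite size. *)
Definition ext_size (x : \bar R) (n : nat) : Prop :=
  ((x = +oo \/ x = -oo) /\ n = 1%N) \/
  exists q : rat, x = (ratr q : R)%:E /\ n = size_rat q.

Definition req_size_le (lam : requirement) (N : nat) : Prop :=
  exists s : V -> nat, (forall v, ext_size (lam v) (s v)) /\
    (#|V| + \sum_(v : V) s v <= N)%N.

End Game.

(* Main.v *)
Require Import Defs.
From mathcomp Require Import all_boot all_order all_algebra.
From mathcomp Require Import boolp classical_sets reals ereal sequences Rstruct.
From mathcomp Require Import topology normedtype derive.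
From mathcomp Require Import perm lra ring zify.

(** Fix a player [i] and consider the game in which a proposer announces the
    next vertex and [i] accepts or deviates, the set of vertices visited since
    the last deviation being recorded.  The proposer must keep the mean payoff
    of [i] below a bound while every proposed play is consistent.  Strategies
    of the proposer can be interleaved, since linear bounds on partial sums add
    up; hence it is enough to beat every positional strategy of [i].  Against
    such a strategy the proposer walks in a finite graph, and wins iff some real
    convex combination of simple cycles of a reachable strongly connected part
    satisfies linear inequalities in the requirement.

    So around the least fixed point [lam] the set of epsilon-fixed points
    contains a polyhedron.  If a direction [d] preserved all tight constraints,
    [lam + t d] and [lam - t d] would both be epsilon-fixed points, against
    minimality.  Eliminating the cycle weights by cofactors, [lam] is therefore
    the only solution of a square integer system whose coefficients have
    polynomially many bits -- the cycles are exponentially long, but only the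
    logarithm of their length matters -- and Cramer's rule bounds its size. *)

Set Implicit Arguments.
Unset Strict Implicit.
Unset Printing Implicit Defensive.

Import Order.TTheory GRing.Theory Num.Theory numFieldNormedType.Exports.
Local Open Scope ring_scope.

(** * Interleaving strategies *)

(** Consistency is demanded after every history, and a limit inferior is not additive, so two
    strategies of the proposer cannot be compared through their mean payoffs. All demands are
    therefore written as bounds [d n + C] on partial sums, for every rate [d]; such bounds only see
    the multiset of steps and survive interleaving. Since [lam <= nego lam] always holds, perturbing
    a fixed point only requires keeping [nego lam <= lam + eps]. This amounts to one linear system
    in cycle weights for each vertex and each positional strategy of the challenger. Such a system
    has exponentially many unknowns but only [|V| + 2] rows, so determinants of that order eliminate
    the unknowns. The weights have to be real, because rationality of [lam] is only known at the
    end. A perturbation of the weights keeps their support, so that they stay nonnegative for both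
    signs of a small parameter. *)

Section Arena.

Variables (K : realType) (Q X : finType).
Variables (legal : Q -> X -> bool) (delta : Q -> X -> X -> Q).
Local Notation step := (Q * X * X)%type.

Definition source (t : step) : Q := t.1.1.
Definition target (t : step) : Q := delta t.1.1 t.1.2 t.2.

(* A strategy of the proposer unfolded into a (possibly infinite) graph: at
   [m] it proposes [cho m], and [nxt m x] is where the answer [x] leads. *)
Record sgraph := SGraph {
  node : Type;
  lab : node -> Q;
  cho : node -> X;
  nxt : node -> X -> node }.

Fixpoint steps (S : sgraph) (m : node S) (xs : seq X) : seq step :=
  if xs is x :: xs' then (lab m, cho m, x) :: steps (nxt m x) xs' else [::].

Fixpoint allowed (A : Q * X -> {set X}) (S : sgraph) (m : node S) (xs : seq X) :=
  if xs is x :: xs' then (x \in A (lab m, cho m)) && allowed A (nxt m x) xs'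
  else true.

Definition sgraph_valid (A : Q * X -> {set X}) (S : sgraph) : Prop :=
  (forall m : node S, legal (lab m) (cho m)) /\
  forall (m : node S) x, x \in A (lab m, cho m) ->
    lab (nxt m x) = delta (lab m) (cho m) x.

Variable good : K -> K -> seq step -> Prop.
(** The rate [d] is common to both parts because lengths add up; only the constants accumulate. *)
Hypothesis good_perm : forall d C1 C2 s1 s2 s, good d C1 s1 -> good d C2 s2 ->
  perm_eq s (s1 ++ s2) -> good d (C1 + C2) s.

(* The additive constant may depend on the node but not on the path: this is
   what lets two such strategies be interleaved. *)
Definition winning (A : Q * X -> {set X}) (S : sgraph) : Prop :=
  forall (m : node S) (d : K), 0 < d ->
    exists C : K, forall xs, allowed A m xs -> good d C (steps m xs).

Definition wins (A : Q * X -> {set X}) (q : Q) : Prop :=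
  exists (S : sgraph) (m : node S),
    [/\ lab m = q, sgraph_valid A S & winning A S].

(** * Merging two strategies that share the answers at one position *)

Section Merge.
Variables (A A1 A2 : Q * X -> {set X}) (s0 : Q * X) (S1 S2 : sgraph).
Hypothesis A1E : forall s, s != s0 -> A1 s = A s.
Hypothesis A2E : forall s, s != s0 -> A2 s = A s.
Hypothesis A12 : A s0 \subset A1 s0 :|: A2 s0.

Local Notation pos1 m := (lab (s := S1) m, cho (s := S1) m).
Local Notation pos2 m := (lab (s := S2) m, cho (s := S2) m).

(* The flag tells which strategy is being played ([true] for [S1]); the other
   one waits at [s0]. *)
Definition merge_inv (n : bool * node S1 * node S2) : Prop :=
  if n.1.1 then pos2 n.2 = s0 else pos1 n.1.2 = s0.

Definition merge_node := {n | merge_inv n}.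

(** Control can change only at [s0]; an answer covered by both [A1] and [A2] leaves the current
    strategy in charge. *)
Definition merge_side (n : bool * node S1 * node S2) (x : X) : bool :=
  let: (b, m1, m2) := n in
  if b then (pos1 m1 != s0) || (x \in A1 s0)
  else (pos2 m2 == s0) && (x \notin A2 s0).

Definition merge_next (n : bool * node S1 * node S2) (x : X) :=
  let: (b, m1, m2) := n in
  if merge_side n x then (true, nxt m1 x, m2) else (false, m1, nxt m2 x).

Lemma merge_nextP (n : merge_node) x : merge_inv (merge_next (sval n) x).
Proof.
case: n => [[[b m1] m2]] inv; rewrite [sval _]/= /merge_next.
case E: (merge_side _ _); move: inv E; rewrite /merge_inv; case: b => //=.
  by move=> _ /andP[/eqP].
by move=> _ /negbT; rewrite negb_or negbK => /andP[/eqP].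
Qed.

Definition merge_sgraph : sgraph :=
  @SGraph merge_node
    (fun n => let: (b, m1, m2) := sval n in if b then lab m1 else lab m2)
    (fun n => let: (b, m1, m2) := sval n in if b then cho m1 else cho m2)
    (fun n x => exist _ _ (merge_nextP n x)).

Lemma merge_valid : sgraph_valid A1 S1 -> sgraph_valid A2 S2 ->
  sgraph_valid A merge_sgraph.
Proof.
move=> [L1 D1] [L2 D2]; split; first by case=> [[[[] m1] m2] /= _].
case=> [[[[] m1] m2]] /=; rewrite /merge_inv /= => inv x xA.
- case: ifP => /= [side|/negbT].
    apply: D1; case: (eqVneq (pos1 m1) s0) side => [->|ne] //= _.
    by rewrite A1E.
  rewrite negb_or negbK => /andP[/eqP e1 xA1].
  have [el ec] : lab m1 = lab m2 /\ cho m1 = cho m2.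
    by move: inv; rewrite -e1 => -[-> ->].
  rewrite el ec; apply: D2; rewrite inv.
  by move: (fintype.subsetP A12 x); rewrite -e1 => /(_ xA); rewrite e1 inE (negbTE xA1).
- case: ifP => /= [/andP[/eqP e2 xA2]|/negbT].
    have [el ec] : lab m1 = lab m2 /\ cho m1 = cho m2.
      by move: inv; rewrite -e2 => -[-> ->].
    rewrite -el -ec; apply: D1; rewrite inv.
    by move: (fintype.subsetP A12 x); rewrite -e2 => /(_ xA); rewrite e2 inE (negbTE xA2) orbF.
  rewrite negb_and negbK => side; apply: D2.
  case: (eqVneq (pos2 m2) s0) side => [->|ne] //= _.
  by rewrite A2E.
Qed.

(** The waiting strategy stands at [s0], so the step at which control passes to it is also a step of
    its own path. Each strategy thus sees its share of the steps as one uninterrupted path. *)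
Lemma merge_steps (n : node merge_sgraph) xs : allowed A n xs ->
  exists ys zs, [/\ allowed A1 (sval n).1.2 ys, allowed A2 (sval n).2 zs
    & perm_eq (steps n xs) (steps (sval n).1.2 ys ++ steps (sval n).2 zs)].
Proof.
elim: xs n => [|x xs IH] n /=; first by exists [::], [::].
move=> /andP[xA /IH[ys [zs [aly alz pe]]]] {IH}.
move: n xA aly alz pe => [[[b m1] m2] inv]; rewrite [sval _]/=.
set n' := exist _ _ _ => xA.
have -> : sval n' = merge_next (b, m1, m2) x by [].
rewrite [merge_next _ _]/=; case: ifP => side aly alz pe.
- exists (x :: ys), zs; split=> //=; last first.
    have -> : (if b then lab m1 else lab m2, if b then cho m1 else cho m2, x)
            = (lab m1, cho m1, x).
      case: b inv side {xA n' pe aly alz} => // inv /andP[/eqP e2 _].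
      by move: inv; rewrite /merge_inv /= -e2 => -[-> ->].
    by rewrite perm_cons.
  rewrite aly andbT; move: inv side xA {n' pe aly alz}.
  rewrite /merge_inv /=; case: b => /=.
    by move=> _; case: eqVneq => [->|/A1E->].
  move=> e1 /andP[/eqP e2 xA2]; rewrite e1 e2 => xA.
  by move: (fintype.subsetP A12 x xA); rewrite inE (negbTE xA2) orbF.
- exists ys, (x :: zs); split=> //=; last first.
    have -> : (if b then lab m1 else lab m2, if b then cho m1 else cho m2, x)
            = (lab m2, cho m2, x).
      case: b inv side {xA n' pe aly alz} => // inv /negbT.
      rewrite negb_or negbK => /andP[/eqP e1 _].
      by move: inv; rewrite /merge_inv /= -e1 => -[-> ->].
    by rewrite perm_sym perm_catC /= perm_cons perm_catC perm_sym.
  rewrite alz andbT; move: inv side xA {n' pe aly alz}.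
  rewrite /merge_inv /=; case: b => /=; last first.
    move=> _ /negbT; rewrite negb_and negbK.
    by case: eqVneq => [->|/A2E->].
  move=> e2 /negbT; rewrite negb_or negbK => /andP[/eqP e1 xA1].
  rewrite e1 e2 => xA.
  by move: (fintype.subsetP A12 x xA); rewrite inE (negbTE xA1).
Qed.

Lemma merge_winning : winning A1 S1 -> winning A2 S2 -> winning A merge_sgraph.
Proof.
move=> W1 W2 n d d0.
have [C1 H1] := W1 (sval n).1.2 d d0.
have [C2 H2] := W2 (sval n).2 d d0.
exists (C1 + C2) => xs /merge_steps[ys [zs [aly alz pe]]].
by apply: good_perm pe; [apply: H1|apply: H2].
Qed.

End Merge.

Lemma wins_merge (A A1 A2 : Q * X -> {set X}) (s0 : Q * X) q :
  (forall s, s != s0 -> A1 s = A s) -> (forall s, s != s0 -> A2 s = A s) ->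
  A s0 \subset A1 s0 :|: A2 s0 -> wins A1 q -> wins A2 q -> wins A q.
Proof.
move=> A1E A2E A12 [S1 [m1 [l1 v1 w1]]] [S2 [m2 [l2 v2 w2]]].
have [[n2 en2]|no2] := pselect (exists n2 : node S2, (lab n2, cho n2) = s0).
  exists (merge_sgraph A1 A2 s0 S1 S2), (exist _ (true, m1, n2) en2); split=> //.
    exact: merge_valid.
  exact: merge_winning.
(* Without a node at [s0], [S2] has no place to wait, but then it never meets the difference between
   [A2] and [A]. *)
have ne (m : node S2) : (lab m, cho m) != s0.
  by apply/eqP => e; apply: no2; exists m.
exists S2, m2; split=> //.
  by case: v2 => L D; split=> // m x; rewrite -A2E //; apply: D.
move=> m d d0; have [C H] := w2 m d d0; exists C => xs al; apply: H.
by elim: xs m al => //= x xs IH m /andP[xA /IH ->]; rewrite A2E // xA.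
Qed.

Lemma wins_sub (A A' : Q * X -> {set X}) q :
  (forall s, A s \subset A' s) -> wins A' q -> wins A q.
Proof.
move=> sAA [S [m [l [L D] w]]]; exists S, m; split=> //.
  by split=> // n x xA; apply: D; apply: (fintype.subsetP (sAA _)).
move=> n d d0; have [C H] := w n d d0; exists C => xs al; apply: H.
by elim: xs n al => //= x xs IH n /andP[/(fintype.subsetP (sAA _))-> /IH].
Qed.

(** Induction on the total number of answers: where two or more remain, one is separated from the
    rest, and the strategies that win the two smaller games are merged. *)
Theorem wins_positional (A : Q * X -> {set X}) q :
  (forall s, A s != finset.set0) ->
  (forall c : {ffun Q * X -> X}, (forall s, c s \in A s) ->
     wins (fun s => [set c s]) q) ->
  wins A q.
Proof.
have [k] := ubnP (\sum_s #|A s|)%N; elim: k => // k IH in A * => ltk A0 Hc.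
have [[s0 s02]|all1] := pselect (exists s0, 1 < #|A s0|)%N; last first.
  have cA s : {x | x \in A s} by apply: cid; apply/finset.set0Pn.
  pose c := [ffun s => sval (cA s)].
  apply: (@wins_sub _ (fun s => [set c s])); last first.
    by apply: Hc => s; rewrite ffunE; apply: (svalP (cA s)).
  move=> s; rewrite ffunE; case: (cA s) => x xA /=.
  have /eqP e : #|A s| == 1%N.
    rewrite eqn_leq lt0n cards_eq0 A0 andbT leqNgt; apply/negP => h.
    by apply: all1; exists s.
  by move/eqP/cards1P: e xA => [y ->]; rewrite inE => /eqP->.
have /finset.set0Pn[x xA] := A0 s0.
pose A1 s := if s == s0 then [set x] else A s.
pose A2 s := if s == s0 then A s :\ x else A s.
have cx : #|A s0| = #|A s0 :\ x|.+1 by rewrite (cardsD1 x) xA.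
have lt1 : (\sum_s #|A1 s| < k)%N.
  rewrite -ltnS; apply: leq_trans ltk; rewrite ltnS (bigD1 s0) //= [X in (_ < X)%N](bigD1 s0) //=.
  rewrite /A1 eqxx cards1 -addSn leq_add //.
  by apply: leq_sum => s /negbTE->.
have lt2 : (\sum_s #|A2 s| < k)%N.
  rewrite -ltnS; apply: leq_trans ltk; rewrite ltnS (bigD1 s0) //= [X in (_ < X)%N](bigD1 s0) //=.
  rewrite /A2 eqxx cx -addSn leq_add //.
  by apply: leq_sum => s /negbTE->.
apply: (@wins_merge A A1 A2 s0).
- by move=> s; rewrite /A1 => /negbTE->.
- by move=> s; rewrite /A2 => /negbTE->.
- rewrite /A1 /A2 eqxx; apply/fintype.subsetP => y yA.
  by rewrite !inE yA andbT orbN.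
- apply: IH lt1 _ _ => [s|c cA].
    by rewrite /A1; case: ifP => // _; apply/finset.set0Pn; exists x; rewrite inE.
  apply: Hc => s; move: (cA s); rewrite /A1; case: eqP => // ->.
  by rewrite inE => /eqP->.
- apply: IH lt2 _ _ => [s|c cA].
    rewrite /A2; case: (eqVneq s s0) => // ->.
    by rewrite -card_gt0; move: s02; rewrite cx.
  apply: Hc => s; move: (cA s); rewrite /A2; case: eqP => // ->.
  by rewrite inE => /andP[].
Qed.

(** Against a fixed answer function there is a single path, so the play itself serves as the
    strategy graph, with dates as nodes. *)
Lemma wins_play (c : Q * X -> X) (e : nat -> step) :
  (forall n, legal (source (e n)) (e n).1.2) ->
  (forall n, (e n).2 = c (e n).1) ->
  (forall n, source (e n.+1) = target (e n)) ->
  (forall m d, 0 < d -> exists C, forall n, good d C [seq e (m + k)%N | k <- iota 0 n]) ->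
  wins (fun s => [set c s]) (source (e 0%N)).
Proof.
move=> Hl Hc Ht Hg.
pose S := @SGraph nat (fun n => source (e n)) (fun n => (e n).1.2) (fun n _ => n.+1).
have eE n : e n = (source (e n), (e n).1.2, c (source (e n), (e n).1.2)).
  by rewrite /source -surjective_pairing -Hc -surjective_pairing.
exists S, 0%N; split=> //.
  split=> [m|m x] /=; first exact: Hl.
  rewrite inE => /eqP->; rewrite Ht /target /source; congr delta.
  by rewrite -surjective_pairing Hc.
move=> m d d0; have [C HC] := Hg m d d0; exists C => xs al.
suff -> : steps (S := S) m xs = [seq e (m + k)%N | k <- iota 0 (size xs)] by [].
elim: xs m al {HC} => //= x xs IH m /andP[]; rewrite inE => /eqP-> /IH ->.
rewrite addn0 -eE; congr cons.
rewrite (iotaDl 1 0) -map_comp; apply: eq_map => k /=.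
by rewrite addnS.
Qed.

End Arena.

(** * Walks and cycles *)

Section Walk.

Variables (Q E : finType) (src tgt : E -> Q).

Fixpoint walk (q : Q) (s : seq E) : bool :=
  if s is e :: s' then (src e == q) && walk (tgt e) s' else true.

Definition endp (q : Q) (s : seq E) : Q := last q [seq tgt e | e <- s].

Lemma endp_cat q s1 s2 : endp q (s1 ++ s2) = endp (endp q s1) s2.
Proof. by rewrite /endp map_cat last_cat. Qed.

Lemma walk_cat q s1 s2 : walk q (s1 ++ s2) = walk q s1 && walk (endp q s1) s2.
Proof. by elim: s1 q => //= e s1 IH q; rewrite IH andbA. Qed.

Definition closed_walk (c : seq E) : bool :=
  (c != [::]) && [exists q, walk q c && (endp q c == q)].

(** Pigeonhole on the [#|Q| + 1] prefixes of length at most [#|Q|], which also bounds the length of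
    the infix. *)
Lemma walk_closed_infix q s : (#|Q| <= size s)%N ->
  exists s1 c s2, [/\ s = s1 ++ c ++ s2, c != [::], (size c <= #|Q|)%N
    & endp (endp q s1) c = endp q s1].
Proof.
move=> szs.
pose f (k : 'I_#|Q|.+1) := endp q (take k s).
have /injectivePn[a [b neq_ab eq_ab]] : ~~ injectiveb f.
  apply/negP => /injectiveP/leq_card; rewrite card_ord; lia.
wlog lt_ab : a b neq_ab eq_ab / (a < b)%N.
  move=> W; case: (ltngtP a b) => [|ltba|e]; first exact: W.
    by apply: (W b a) => //; rewrite eq_sym.
  by case/negP: neq_ab; apply/eqP/val_inj.
have bQ : (b <= #|Q|)%N by rewrite -ltnS.
exists (take a s), (drop a (take b s)), (drop b s); split.
- rewrite catA -{1}(cat_take_drop b s); congr (_ ++ _).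
  by rewrite -{1}(cat_take_drop a (take b s)) take_takel // ltnW.
- by rewrite -size_eq0 size_drop size_takel -?lt0n ?subn_gt0 // (leq_trans bQ).
- by rewrite size_drop size_takel ?(leq_trans (leq_subr _ _)) // (leq_trans bQ).
- rewrite -endp_cat -[RHS]/(f a) eq_ab /f; congr endp.
  rewrite -{2}(cat_take_drop a (take b s)) take_takel //; exact: ltnW.
Qed.

Lemma walk_decomposition q s : walk q s ->
  exists (cs : seq (seq E)) (rest : seq E),
    [/\ perm_eq s (flatten cs ++ rest), (size rest <= #|Q|)%N
      & forall c, c \in cs -> closed_walk c && (size c <= #|Q|)%N].
Proof.
have [k] := ubnP (size s); elim: k s => // k IH s ltk ws.
have [szs|szs] := leqP (size s) #|Q|.
  by exists [::], s; rewrite perm_refl.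
have [s1 [c [s2 [es c0 szc ec]]]] := walk_closed_infix q (ltnW szs).
have [w1 wc w2] : [/\ walk q s1, walk (endp q s1) c & walk (endp q s1) s2].
  by move: ws; rewrite es !walk_cat ec => /and3P[].
have ltc : (0 < size c)%N by rewrite lt0n size_eq0.
have [||cs [rest [pe szr Hcs]]] := IH (s1 ++ s2).
- rewrite -ltnS (leq_trans _ ltk) // es !size_cat ltnS ltn_add2l.
  by rewrite -{1}[size s2]add0n ltn_add2r.
- by rewrite walk_cat w1.
exists (c :: cs), rest; split=> //.
  by rewrite es perm_catCA /= -catA perm_cat2l.
move=> c'; rewrite inE => /predU1P[->|/Hcs//].
rewrite szc andbT /closed_walk c0 /=; apply/existsP; exists (endp q s1).
by rewrite wc ec eqxx.
Qed.

Lemma walk_map_iota (e : nat -> E) a n :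
  (forall k, src (e k.+1) = tgt (e k)) ->
  walk (src (e a)) [seq e k | k <- iota a n] /\
  endp (src (e a)) [seq e k | k <- iota a n] = src (e (a + n)%N).
Proof.
move=> He; elim: n a => [|n IH] a /=; first by rewrite addn0.
have [w en] := IH a.+1.
by rewrite eqxx -He w /=; split=> //; rewrite /endp /= -He addnS.
Qed.

End Walk.

(** * Concatenating infinitely many closed walks *)

Section Concat.

Variables (K : realType) (Q E : finType) (src tgt : E -> Q).
Variables (b : Q) (w : nat -> seq E) (x0 : E).
Hypothesis w_neq0 : forall n, w n != [::].

(** The state holds the index of the current block and the part of it still to be emitted, which is
    never empty. *)
Fixpoint cstate (k : nat) : nat * seq E :=
  if k is k'.+1 then
    let: (n, s) := cstate k' in
    if behead s is [::] then (n.+1, w n.+1) else (n, behead s)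
  else (0%N, w 0%N).

Definition concat (k : nat) : E := head x0 (cstate k).2.

Lemma cstate_neq0 k : (cstate k).2 != [::].
Proof.
case: k => [|k] /=; first exact: w_neq0.
by case: (cstate k) => n [|x [|y s]] /=.
Qed.

Lemma cstate_suffix k : exists s, w (cstate k).1 = s ++ (cstate k).2.
Proof.
elim: k => [|k [s]] /=; first by exists [::].
have := cstate_neq0 k; case: (cstate k) => n [|x [|y t]] //= _.
  by move=> _; exists [::].
by move=> ->; exists (rcons s x); rewrite cat_rcons.
Qed.

Lemma cstate_sum (V : zmodType) (g : E -> V) k :
  \sum_(j < k) g (concat j) + \sum_(e <- (cstate k).2) g e =
  \sum_(m < (cstate k).1.+1) \sum_(e <- w m) g e.
Proof.
elim: k => [|k IH]; first by rewrite big_ord0 add0r big_ord_recl big_ord0 addr0.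
rewrite big_ord_recr /= /concat; have := cstate_neq0 k; move: IH.
case: (cstate k) => n [|x [|y t]] //= IH _.
  by rewrite big_ord_recr /= -IH big_seq1.
by rewrite -IH [in RHS]big_cons addrA.
Qed.

Lemma cstate_addn k n s1 s2 : cstate k = (n, s1 ++ s2) -> s2 != [::] ->
  cstate (k + size s1) = (n, s2).
Proof.
elim: s1 k => [|x s1 IH] k /= Hk s20; first by rewrite addn0.
rewrite addnS -addSn; apply: IH => //=; rewrite Hk /=.
by case: s1 {Hk} => [|y s1] //=; case: s2 s20.
Qed.

Lemma cstate_next k n s : cstate k = (n, s) ->
  cstate (k + size s) = (n.+1, w n.+1).
Proof.
move=> Hk; have := cstate_neq0 k; rewrite Hk /=.
case/lastP: s Hk => // s x Hk _; rewrite size_rcons addnS /=.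
by rewrite (@cstate_addn k n s [:: x]) // cats1.
Qed.

Lemma concat_inf_often (x : E) : (forall n, x \in w n) ->
  forall k, exists2 k', (k <= k')%N & concat k' = x.
Proof.
move=> xw k; case Hk: (cstate k) => [n s].
have Hn := cstate_next Hk.
have /splitPr ws := xw n.+1.
case Ew: (w n.+1) / ws => [s1 s2].
exists (k + size s + size s1)%N; first by rewrite -addnA leq_addr.
by rewrite /concat (@cstate_addn _ n.+1 s1 (x :: s2)) // Hn Ew.
Qed.

Hypothesis w_walk : forall n, walk src tgt b (w n) /\ endp tgt b (w n) = b.

Lemma cstate_walk k : walk src tgt (src (concat k)) (cstate k).2 /\
  endp tgt (src (concat k)) (cstate k).2 = b.
Proof.
have [s] := cstate_suffix k; rewrite /concat.
have := cstate_neq0 k; case: (cstate k) => n [|x t] //= _.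
move: (w_walk n) => [W e] ew; rewrite eqxx /=.
by move: W e; rewrite ew walk_cat endp_cat /= => /and3P[_ _ ->] <-.
Qed.

Lemma concat_src0 : src (concat 0) = b.
Proof.
rewrite /concat /=; have := w_neq0 0; have [] := w_walk 0.
by case: (w 0%N) => //= x s /andP[/eqP].
Qed.

Lemma concat_src k : src (concat k.+1) = tgt (concat k).
Proof.
have [] := cstate_walk k; rewrite /concat /=.
have := cstate_neq0 k; case: (cstate k) => n [|x [|y t]] //= _.
  move=> _; rewrite /endp /= => ->.
  have := w_neq0 n.+1; have [] := w_walk n.+1.
  by case: (w n.+1) => //= x' s /andP[/eqP].
by move=> /andP[_ /andP[/eqP]].
Qed.

Lemma concat_in k : exists n, concat k \in w n.
Proof.
have [s es] := cstate_suffix k; exists (cstate k).1; rewrite es mem_cat /concat.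
by have := cstate_neq0 k; case: (cstate k).2 => //= x t _; rewrite inE eqxx orbT.
Qed.

Lemma sum_normB (g : E -> K) (s : seq E) :
  `|\sum_(e <- s) g e| <= (\sum_e `|g e|) * (size s)%:R.
Proof.
elim: s => [|e s IH]; first by rewrite big_nil normr0 mulr0.
rewrite big_cons (le_trans (ler_normD _ _)) //= -natr1 mulrDr mulr1 addrC lerD //.
by rewrite (bigD1 e) //= lerDl sumr_ge0.
Qed.

(* Stage [n] has length [n + O(1)] and total weight [O(1)], so after [n] stages
   the weight is [O(n)] while the length is quadratic in [n]. *)
Lemma concat_sum (g : E -> K) (L D : K) :
  (forall n, `|\sum_(e <- w n) g e| <= D) ->
  (forall n, `|(size (w n))%:R - n%:R| <= L) ->
  forall d, 0 < d -> exists C, forall k, `|\sum_(j < k) g (concat j)| <= d * k%:R + C.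
Proof.
move=> HD HL d d0.
pose G := \sum_e `|g e|.
have G0 : 0 <= G by apply: sumr_ge0.
have L0 : 0 <= L := le_trans (normr_ge0 _) (HL 0%N).
have D0 : 0 <= D := le_trans (normr_ge0 _) (HD 0%N).
(* The constants complete a square: the partial sum is at most [K2 (n + 1)] and [k] is at least
   [n (n - 1) / 2 - L n], so the claim reduces to [0 <= (d n - B)^2 / (2 d)]. *)
pose K2 := D + G + G * L.
pose B := d / 2 + d * L + K2.
exists (K2 + B ^+ 2 / (2 * d)) => k.
have [s es] := cstate_suffix k.
have Hsum := cstate_sum g k.
have Hlen := cstate_sum (fun=> 1 : K) k.
move: es Hsum Hlen; case: (cstate k) => n t /= es Hsum Hlen.
have szw : (size t)%:R <= (size (w n))%:R :> K.
  by rewrite ler_nat es size_cat leq_addl.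
have szn : (size (w n))%:R <= n%:R + L.
  by have := HL n; rewrite ler_norml => /andP[_]; lra.
have Ht : `|\sum_(e <- t) g e| <= G * (n%:R + L).
  apply: (le_trans (sum_normB _ _)); rewrite ler_wpM2l //.
  exact: le_trans szw szn.
have Hw m : `|\sum_(i < m) \sum_(e <- w i) g e| <= D * m%:R.
  elim: m => [|m IH]; first by rewrite big_ord0 normr0 mulr0.
  rewrite big_ord_recr /= (le_trans (ler_normD _ _)) // -natr1 mulrDr mulr1.
  by rewrite lerD.
have bound : `|\sum_(j < k) g (concat j)| <= K2 * (n%:R + 1).
  have -> : \sum_(j < k) g (concat j) =
            \sum_(m < n.+1) \sum_(e <- w m) g e - \sum_(e <- t) g e.
    by rewrite -Hsum addrK.
  apply: (le_trans (ler_normB _ _)).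
  have := Hw n.+1; rewrite -natr1 => H1.
  apply: (le_trans (lerD H1 Ht)).
  have : 0 <= G * L * n%:R by rewrite !mulr_ge0.
  rewrite /K2; nra.
have one_sum (u : seq E) : \sum_(e <- u) 1 = (size u)%:R :> K.
  by rewrite big_const_seq iter_addr_0 count_predT.
have klen : n%:R * (n%:R - 1) / 2 - L * n%:R <= k%:R :> K.
  move: Hlen; rewrite sumr_const card_ord one_sum big_ord_recr /= one_sum => Hlen.
  have H2 m : m%:R * (m%:R - 1) / 2 - L * m%:R <= \sum_(i < m) \sum_(e <- w i) 1 :> K.
    elim: m => [|m IH]; first by rewrite big_ord0; lra.
    rewrite big_ord_recr /= one_sum -natr1.
    have := HL m; rewrite ler_norml => /andP[H _]; nra.
  have := H2 n; rewrite -/(k%:R : K) in Hlen *; lra.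
apply: (le_trans bound).
have e1 : d * (n%:R * (n%:R - 1) / 2 - L * n%:R) <= d * k%:R by rewrite ler_pM2l.
have e2 : 0 <= (d * n%:R - B) ^+ 2 / (2 * d).
  by apply: divr_ge0; [exact: sqr_ge0|lra].
have e3 : (d * n%:R - B) ^+ 2 / (2 * d) =
    d * n%:R ^+ 2 / 2 - B * n%:R + B ^+ 2 / (2 * d).
  by field; lra.
rewrite e3 in e2; rewrite {1}/B in e2; nra.
Qed.

End Concat.

(** * Realizing cycle weights by an infinite path *)

Section Cycles.

Variables (K : realType) (Q E : finType) (src tgt : E -> Q) (I : {set E}).

(** Closed walks of length at most [#|Q|] stand in for simple cycles: they form a finite type and
    their weights obey the same bound. *)
Definition is_cycle (C : #|Q|.-bseq E) : bool :=
  closed_walk src tgt C && all (mem I) C.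

Definition cycle_in := {C : #|Q|.-bseq E | is_cycle C}.

Definition weight (g : E -> K) (C : cycle_in) : K := \sum_(x <- bseqval (val C)) g x.

Definition mean (p : cycle_in -> K) (g : E -> K) : K := \sum_C p C * weight g C.

Variables (e : nat -> E) (T0 : nat).
Hypothesis e_src : forall k, src (e k.+1) = tgt (e k).
Hypothesis e_tail : forall k, (T0 <= k)%N -> e k \in I.
Hypothesis e_inf : forall x, x \in I -> forall k, exists2 k', (k <= k')%N & e k' = x.

Local Notation b := (src (e T0)).

(** The segment of the path from [T0] until all of [I] has been seen and [e T0] comes back. It meets
    every cycle inside [I], so it connects them all. *)
Lemma covering_walk : exists z, [/\ z != [::], walk src tgt b z, endp tgt b z = b,
  all (mem I) z & forall x, x \in I -> x \in z].
Proof.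
have pos (x : E) : {k | x \in I -> (T0 <= k)%N /\ e k = x}.
  apply: cid; case: (boolP (x \in I)) => xI; last by exists 0%N.
  by have [k ? ?] := e_inf xI T0; exists k.
pose M := \max_x sval (pos x).
have [T1 T1M eT1] := e_inf (e_tail (leqnn T0)) (maxn M T0).+1.
exists [seq e k | k <- iota T0 (T1 - T0)].
have [W en] := walk_map_iota T0 (T1 - T0) e_src.
split=> //.
- by rewrite -size_eq0 size_map size_iota; lia.
- by rewrite en subnKC ?eT1 //; lia.
- by apply/allP => x /mapP[k]; rewrite mem_iota => /andP[h _] ->; apply: e_tail.
- move=> x xI; have [T0k ek] := svalP (pos x) xI.
  apply/mapP; exists (sval (pos x)); rewrite ?ek // mem_iota T0k /=.
  have : (sval (pos x) <= M)%N by apply: (leq_bigmax x).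
  lia.
Qed.

Lemma flatten_walk (q : Q) (ss : seq (seq E)) :
  (forall s, s \in ss -> walk src tgt q s /\ endp tgt q s = q) ->
  walk src tgt q (flatten ss) /\ endp tgt q (flatten ss) = q.
Proof.
elim: ss => //= s ss IH H.
have [W en] := H s (mem_head _ _).
have [|W' en'] := IH; first by move=> s' h; apply: H; rewrite inE h orbT.
by rewrite walk_cat endp_cat en W W' en'.
Qed.

Lemma cycle_insertion z : walk src tgt b z -> (forall x, x \in I -> x \in z) ->
  forall C : cycle_in, exists a : seq E * seq E, [/\ z = a.1 ++ a.2,
    walk src tgt (endp tgt b a.1) (val C) &
    endp tgt (endp tgt b a.1) (val C) = endp tgt b a.1].
Proof.
move=> Wz zI [C /= /andP[/andP[C0 /existsP[q /andP[Wq /eqP eq]]] /allP CI]].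
case EC: (bseqval C) (C0) (Wq) => [//|x C'] _ /= /andP[/eqP sx _].
have /zI/splitPr zx : x \in I by apply: CI; rewrite EC mem_head.
case Ez: z / zx => [a1 a2].
exists (a1, x :: a2) => /=.
have -> : endp tgt b a1 = q.
  by move: Wz; rewrite Ez walk_cat /= => /and3P[_ /eqP <-].
by move: Wq eq; rewrite EC.
Qed.

Lemma sum_flatten_nseq (g : E -> K) (k : nat) (s : seq E) :
  \sum_(x <- flatten (nseq k s)) g x = k%:R * \sum_(x <- s) g x.
Proof.
elim: k => [|k IH] /=; first by rewrite big_nil mul0r.
by rewrite big_cat /= IH -natr1 mulrDl mul1r addrC.
Qed.

(** Block [n] repeats each cycle [C] about [n p(C)] times. Total weight 1 makes its length
    [n + O(1)], and for each [g] its weight is [n] times the mean up to a constant. Growing blocks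
    are what lets real weights be attained in the limit. *)
Theorem cycles_realizable (p : cycle_in -> K) :
  (forall C, 0 <= p C) -> mean p (fun=> 1) = 1 ->
  exists e' : nat -> E,
   [/\ (forall k, src (e' k.+1) = tgt (e' k)) /\ src (e' 0%N) = src (e 0%N),
       forall k, exists k', e' k = e k',
       forall k, (T0 <= k)%N -> e' k \in I,
       forall x, x \in I -> forall k, exists2 k', (k <= k')%N & e' k' = x
     & forall (g : E -> K) d, 0 < d -> exists C, forall n,
         `|\sum_(k < n) g (e' k) - n%:R * mean p g| <= d * n%:R + C].
Proof.
move=> p0 p1; have [z [z0 Wz ez zI Iz]] := covering_walk.
have [a Ha] := choice (cycle_insertion Wz Iz).
pose cnt n C := Num.truncn (n%:R * p C).
pose block n (C : cycle_in) :=
  (a C).1 ++ flatten (nseq (cnt n C) (val C : seq E)) ++ (a C).2.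
pose w n := z ++ flatten [seq block n C | C <- enum {: cycle_in}].
have w0 n : w n != [::] by rewrite /w; case: (z) z0.
have w_walk n : walk src tgt b (w n) /\ endp tgt b (w n) = b.
  rewrite /w walk_cat endp_cat Wz ez /=; apply: flatten_walk => s /mapP[C _ ->].
  have [zE WC eC] := Ha C.
  have [|Wf ef] := @flatten_walk (endp tgt b (a C).1)
    (nseq (cnt n C) (val C : seq E)).
    by move=> s' /nseqP[-> _].
  move: Wz ez; rewrite zE /block !walk_cat !endp_cat => /andP[W1 W2] e2.
  by rewrite W1 Wf ef W2 e2.
have wI n : all (mem I) (w n).
  rewrite all_cat zI; apply/allP => x /flattenP[s /mapP[C _ ->]].
  have [zE _ _] := Ha C; move: zI; rewrite zE all_cat => /andP[z1 z2].
  rewrite !mem_cat => /or3P[|/flattenP[s' /nseqP[-> _]]|]; try exact/allP.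
  by case/andP: (valP C) => _ /allP; apply.
have block_sum n C g : \sum_(x <- block n C) g x =
    \sum_(x <- z) g x + (cnt n C)%:R * weight g C.
  have [zE _ _] := Ha C.
  by rewrite /block !big_cat /= sum_flatten_nseq zE big_cat /= [_ * _ + _]addrC addrA.
have w_sum n g : \sum_(x <- w n) g x =
    \sum_(x <- z) g x + \sum_C (\sum_(x <- z) g x + (cnt n C)%:R * weight g C).
  rewrite /w big_cat /= big_flatten big_map -big_enum /=; congr (_ + _).
  by apply: eq_bigr => C _; rewrite block_sum.
have cnt_err n C : `|(cnt n C)%:R - n%:R * p C| <= 1.
  have np : 0 <= n%:R * p C by rewrite mulr_ge0.
  have /andP[] := truncn_itv np; rewrite -natr1 -/(cnt n C) => h1 h2.
  by rewrite ler_norml; lra.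
pose D g := `|\sum_(x <- z) g x| + \sum_C (`|\sum_(x <- z) g x| + `|weight g C|).
have w_err n g : `|\sum_(x <- w n) g x - n%:R * mean p g| <= D g.
  have -> : \sum_(x <- w n) g x - n%:R * mean p g = \sum_(x <- z) g x +
      \sum_C (\sum_(x <- z) g x + ((cnt n C)%:R - n%:R * p C) * weight g C).
    rewrite w_sum /mean mulr_sumr -addrA -sumrB; congr (_ + _).
    by apply: eq_bigr => C _; ring.
  apply: (le_trans (ler_normD _ _)); rewrite lerD2l.
  apply: (le_trans (ler_norm_sum _ _ _)); apply: ler_sum => C _.
  apply: (le_trans (ler_normD _ _)); rewrite lerD2l normrM.
  by rewrite ler_piMl.
have one_sum (u : seq E) : \sum_(x <- u) 1 = (size u)%:R :> K.
  by rewrite big_const_seq iter_addr_0 count_predT.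
have w_size n : `|(size (w n))%:R - n%:R| <= D (fun=> 1).
  by have := w_err n (fun=> 1); rewrite p1 mulr1 one_sum.
pose f := concat w (e 0%N).
pose e' k := if (k < T0)%N then e k else f (k - T0)%N.
have fI k : f k \in I.
  by have [n] := concat_in (e 0%N) w0 k; apply: (allP (wI n)).
exists e'; split.
- split=> [k|]; rewrite /e'.
    case: (ltngtP k.+1 T0) => [lt|lt|eqT].
    + exact: e_src.
    + by rewrite subSn // /f (concat_src (e 0%N) w0 w_walk).
    + by rewrite -eqT subnn /f (concat_src0 (e 0%N) w0 w_walk) -eqT e_src.
  case: ltnP => //; rewrite leqn0 => /eqP T00.
  by rewrite T00 subnn /f (concat_src0 (e 0%N) w0 w_walk) T00.
- move=> k; rewrite /e'; case: ifP => _; first by exists k.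
  by have [k' _ <-] := e_inf (fI (k - T0)%N) 0; exists k'.
- by move=> k Tk; rewrite /e' ltnNge Tk; apply: fI.
- move=> x xI k.
  have [n|k' kk' ek'] := @concat_inf_often _ w (e 0%N) w0 x _ k.
    by rewrite mem_cat Iz.
  by exists (T0 + k')%N; [lia|rewrite /e' ltnNge leq_addr /= addKn].
(* Subtracting the mean makes the block weights bounded, as [concat_sum] requires. *)
- move=> g d d0; pose g' x := g x - mean p g.
  have sum_g' (s : seq E) :
      \sum_(x <- s) g' x = \sum_(x <- s) g x - (size s)%:R * mean p g.
    by rewrite /g' sumrB big_const_seq iter_addr_0 count_predT mulr_natl.
  have mean_g' : mean p g' = 0.
    rewrite /mean /weight; under eq_bigr do rewrite sum_g' -one_sum mulrBr mulrA.
    by rewrite sumrB -mulr_suml -/(mean p g) -/(mean p (fun=> 1)) p1 mul1r subrr.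
  have wD n : `|\sum_(x <- w n) g' x| <= D g'.
    by have := w_err n g'; rewrite mean_g' mulr0 subr0.
  have [C HC] := concat_sum (e 0%N) w0 wD w_size d0.
  have sumf m : \sum_(k < T0 + m) g' (e' k) =
      \sum_(k < T0) g' (e k) + \sum_(k < m) g' (f k).
    rewrite big_split_ord /=; congr (_ + _); apply: eq_bigr => k _; rewrite /e'.
      by rewrite ltn_ord.
    by rewrite ltnNge leq_addr addKn.
  pose G := \sum_x `|g' x|.
  have gG x : `|g' x| <= G by rewrite /G (bigD1 x) //= lerDl sumr_ge0.
  have G0 : 0 <= G by apply: sumr_ge0.
  have C0 : 0 <= C by have := HC 0%N; rewrite big_ord0 normr0 mulr0 add0r.
  have small (h : nat -> K) m : (forall k, `|h k| <= G) ->
      `|\sum_(k < m) h k| <= G * m%:R.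
    move=> hG; elim: m => [|m IH]; first by rewrite big_ord0 normr0 mulr0.
    rewrite big_ord_recr /= (le_trans (ler_normD _ _)) // -natr1 mulrDr mulr1.
    by rewrite lerD.
  exists (C + G * T0%:R) => n.
  have -> : \sum_(k < n) g (e' k) - n%:R * mean p g = \sum_(k < n) g' (e' k).
    by rewrite sumrB sumr_const card_ord mulr_natl.
  have [nT|Tn] := leqP n T0.
    apply: (le_trans (small (fun k => g' (e' k)) n _)) => //.
    have : G * n%:R <= G * T0%:R by rewrite ler_wpM2l // ler_nat.
    have : 0 <= d * n%:R by rewrite mulr_ge0 // ltW.
    lra.
  have nE : n = (T0 + (n - T0))%N by lia.
  rewrite nE sumf (le_trans (ler_normD _ _)) // natrD mulrDr.
  have := HC (n - T0)%N; have := small (fun k => g' (e k)) T0 (fun=> gG _).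
  have : 0 <= d * T0%:R by rewrite mulr_ge0 // ltW.
  rewrite /f; lra.
Qed.

End Cycles.

(** * Extracting cycle weights from a path *)

Section Frequencies.

Variables (K : realType) (Q E : finType) (src tgt : E -> Q) (I : {set E}).
Variables (e : nat -> E) (T0 : nat).
Hypothesis e_src : forall k, src (e k.+1) = tgt (e k).
Hypothesis e_tail : forall k, (T0 <= k)%N -> e k \in I.

Local Notation cyc := (cycle_in src tgt I).

Lemma sum_count_mem (T : finType) (s : seq T) (F : T -> K) :
  \sum_x (count_mem x s)%:R * F x = \sum_(x <- s) F x.
Proof.
elim: s => [|y s IH] /=; first by rewrite big_nil big1 // => x _; rewrite mul0r.
rewrite big_cons -IH -(big_pred1_eq +%R y F) [in RHS]big_mkcond -big_split /=.
by apply: eq_bigr => x _; rewrite natrD mulrDl eq_sym; case: eqP => //= _; rewrite ?mul1r ?mul0r.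
Qed.

(** Cycle counts are divided by [n], so the total weight is only close to 1: the first [T0] edges
    and a remainder of at most [#|Q|] edges are lost. The bound by 1 prepares a compactness
    argument. *)
Lemma cycle_frequencies n : (0 < n)%N -> (T0 <= n)%N ->
  exists p : cyc -> K, (forall C, 0 <= p C <= 1) /\
    forall g : E -> K, `|mean p g - (\sum_(k < n) g (e k)) / n%:R| <=
      (\sum_x `|g x|) * (T0 + #|Q|)%:R / n%:R.
Proof.
move=> n0 T0n.
have nR : 0 < n%:R :> K by rewrite ltr0n.
have [W _] := walk_map_iota T0 (n - T0) e_src.
set s := [seq _ | _ <- _] in W.
have [cs [rest [pe szr Hcs]]] := walk_decomposition W.
have sI : all (mem I) s.
  by apply/allP => x /mapP[k]; rewrite mem_iota => /andP[h _] ->; apply: e_tail.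
have csI c : c \in cs -> all (mem I) c.
  move=> ccs; apply/allP => x xc; apply: (allP sI); rewrite (perm_mem pe) mem_cat.
  by apply/orP; left; apply/flattenP; exists c.
(* [None] is the value outside [cs], as the type of cycles may be empty. *)
have /choice[f Hf] : forall c : seq E, exists C : option cyc,
    c \in cs -> exists2 C', C = Some C' & bseqval (val C') = c.
  move=> c; case: (boolP (c \in cs)) => ccs; last by exists None.
  have /andP[cl sz] := Hcs c ccs.
  have cP : is_cycle src tgt I (Bseq sz) by rewrite /is_cycle /= cl csI.
  by exists (Some (Sub (Bseq sz) cP)) => _; exists (Sub (Bseq sz) cP).
pose cs' := pmap f cs.
have cs'E : [seq bseqval (val C) | C : cyc <- cs'] = cs.
  rewrite /cs'; elim: (cs) (Hf) => //= c l IH H.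
  have [C' -> <-] := H c (mem_head _ _).
  by rewrite /= IH // => c' h; apply: H; rewrite inE h orbT.
have sum_cs g : \sum_(C <- cs') weight g C = \sum_(x <- flatten cs) g x.
  by rewrite big_flatten -cs'E big_map.
have szcs : (size cs <= n)%N.
  apply: (@leq_trans (size (flatten cs))).
    elim: (cs) (Hcs) => //= c l IH H; rewrite size_cat.
    have /andP[/andP[c0 _] _] := H c (mem_head _ _).
    have hl := IH (fun c' h => H c' (@mem_behead _ (c :: l) c' h)).
    by rewrite -add1n leq_add // lt0n size_eq0.
  have := perm_size pe; rewrite size_cat /s size_map size_iota => h.
  by rewrite (leq_trans _ (leq_subr T0 n)) // h leq_addr.
exists (fun C => (count_mem C cs')%:R / n%:R); split=> [C|g].
  rewrite divr_ge0 //= ler_pdivrMr // mul1r ler_nat.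
  apply: leq_trans (count_size _ _) _.
  by rewrite -(size_map (fun C : cyc => bseqval (val C))) cs'E.
have meanE : mean (fun C => (count_mem C cs')%:R / n%:R) g =
    (\sum_(x <- flatten cs) g x) / n%:R.
  rewrite -sum_cs -sum_count_mem mulr_suml /mean.
  by apply: eq_bigr => C _; rewrite mulrAC.
rewrite meanE -mulrBl normrM normfV (ger0_norm (ltW nR)) ler_wpM2r ?invr_ge0 //.
have -> : \sum_(k < n) g (e k) =
    \sum_(k < T0) g (e k) + (\sum_(x <- flatten cs) g x + \sum_(x <- rest) g x).
  rewrite -big_cat /= -(perm_big _ pe) /s big_map.
  rewrite -(big_mkord xpredT (fun k => g (e k))) (@big_cat_nat _ _ _ T0) //=.
  by rewrite big_mkord.
have -> (a b c : K) : b - (a + (b + c)) = - (a + c) by ring.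
rewrite normrN (le_trans (ler_normD _ _)) // natrD mulrDr lerD //.
  have := @sum_normB K E g [seq e k | k <- iota 0 T0].
  by rewrite big_map size_map size_iota -/(index_iota 0 T0) -{1}(subn0 T0) big_mkord.
apply: (le_trans (sum_normB _ _)); rewrite ler_wpM2l ?ler_nat //.
by apply: sumr_ge0.
Qed.

End Frequencies.

(** * Linear systems *)

Lemma sum_continuous (K : realType) (T : topologicalType) (I : Type) (s : seq I)
    (F : I -> T -> K) :
  (forall i, continuous (F i)) -> continuous (fun u => \sum_(i <- s) F i u).
Proof.
move=> Fc; elim: s => [|i s IH] u.
  rewrite (_ : (fun _ => _) = fun=> 0); last by apply: funext => v; rewrite big_nil.
  exact: cvg_cst.
rewrite (_ : (fun _ => _) = fun v => F i v + \sum_(j <- s) F j v).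
  by apply: cvgD; [exact: Fc|exact: IH].
by apply: funext => v; rewrite big_cons.
Qed.

(** The sum of the violations is continuous and attains its minimum on the unit cube; approximate
    solvability forces this minimum to be 0. *)
Lemma linear_system_closed (K : realType) (T J : finType) (a : J -> T -> K) (b : J -> K) :
  (forall d, 0 < d -> exists p : T -> K, (forall x, 0 <= p x <= 1) /\
     forall j, \sum_x p x * a j x <= b j + d) ->
  exists p : T -> K, (forall x, 0 <= p x <= 1) /\ forall j, \sum_x p x * a j x <= b j.
Proof.
move=> H.
pose n := #|T|.
pose f (u : 'rV[K]_n) : K :=
  \sum_j Num.max 0 (\sum_(k < n) u ord0 k * a j (enum_val k) - b j).
pose A := [set u : 'rV[K]_n | forall k, u ord0 k \in `[0, 1]%R]%classic.
have lin_c j : continuous (fun u : 'rV[K]_n => \sum_(k < n) u ord0 k * a j (enum_val k)).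
  apply: sum_continuous => k u; exact: (cvgM (@coord_continuous K 1 n ord0 k u) (cvg_cst _)).
have diff_c j : continuous
    (fun u : 'rV[K]_n => \sum_(k < n) u ord0 k * a j (enum_val k) - b j).
  by move=> u; exact: (cvgB (lin_c j u) (cvg_cst _)).
have fc : continuous f.
  apply: sum_continuous => j u; apply: (@continuous_max K _ (fun=> 0)
    (fun u : 'rV[K]_n => \sum_(k < n) u ord0 k * a j (enum_val k) - b j)).
    exact: cst_continuous.
  exact: diff_c.
have cA : compact A.
  apply (@rV_compact K n (fun=> `[0%R, 1%R]%classic)).
  by move=> _; apply: segment_compact.
have sumE (p : T -> K) j : \sum_(k < n) (\row_k p (enum_val k)) ord0 k * a j (enum_val k)
   = \sum_x p x * a j x.
  under eq_bigr do rewrite mxE.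
  by rewrite -(big_enum_val (fun x => p x * a j x)).
have pA (p : T -> K) : (forall x, 0 <= p x <= 1) -> (\row_k p (enum_val k)) \in A.
  by move=> p01; rewrite inE => k; rewrite /= mxE in_itv /=.
have [||u uA umin] := @EVT_min_rV K n f A _ cA.
- have [p [p01 _]] := H 1 ltr01.
  by exists (\row_k p (enum_val k)); have := pA p p01; rewrite inE.
- exact: continuous_subspaceT.
have f_small d : 0 < d -> f u <= d.
  move=> d0; pose d' := d / (#|J|.+1)%:R.
  have d'0 : 0 < d' by rewrite divr_gt0.
  have [p [p01 pb]] := H d' d'0.
  apply: (le_trans (umin _ (pA p p01))).
  apply: (@le_trans _ _ (\sum_(j : J) d')).
    by apply: ler_sum => j _; rewrite sumE ge_max (ltW d'0) lerBlDl pb.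
  rewrite sumr_const -mulr_natr /d' -mulrA ler_piMr ?ltW //.
  by rewrite mulrC ltr_pdivrMr // mul1r ltr_nat.
have f0 : f u <= 0.
  by apply/ler_addgt0Pr => d d0; rewrite add0r f_small.
exists (fun x => u ord0 (enum_rank x)); split=> [x|j].
  by move: uA; rewrite inE => /(_ (enum_rank x)); rewrite /= in_itv.
have : Num.max 0 (\sum_(k < n) u ord0 k * a j (enum_val k) - b j) <= 0.
  apply: le_trans f0; rewrite /f (bigD1 j) //= lerDl sumr_ge0 // => i _.
  by rewrite le_max lexx.
rewrite ge_max => /andP[_]; rewrite subr_le0; apply: le_trans.
rewrite (big_enum_val (fun x => u ord0 (enum_rank x) * a j x)) /= le_eqVlt.
by apply/orP; left; apply/eqP/eq_bigr => k _; rewrite enum_valK.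
Qed.

(** * Determinants and Cramer's rule with small integers *)

Section SmallIntegers.

Variable K : realType.

Lemma det_int n (M : 'M[K]_n) :
  (forall i j, M i j \is a Num.int) -> \det M \is a Num.int.
Proof.
move=> Mi; apply: rpred_sum => s _; apply: rpredM; first by rewrite rpredX ?rpredN ?rpred1.
by apply: rpred_prod.
Qed.

Lemma det_norm_le n (M : 'M[K]_n) (H : K) :
  (forall i j, `|M i j| <= H) -> `|\det M| <= n`!%:R * H ^+ n.
Proof.
move=> MH; apply: (le_trans (ler_norm_sum _ _ _)).
apply: (@le_trans _ _ (\sum_(s : 'S_n) H ^+ n)).
  apply: ler_sum => s _; rewrite normrM normrX normrN1 expr1n mul1r normr_prod.
  rewrite -[in leRHS](card_ord n) -prodr_const; apply: ler_prod => i _.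
  by rewrite normr_ge0 MH.
by rewrite sumr_const card_Sn mulr_natl.
Qed.

(** Cofactors along column [l] do not involve that column, so its entries may be arbitrary reals.
    This is how a real vector can have an integral separating functional. *)
Lemma cofactor_small n (M : 'M[K]_n) (l : 'I_n) (H : K) :
  (forall i j, j != l -> M i j \is a Num.int /\ `|M i j| <= H) ->
  forall k, cofactor M k l \is a Num.int /\ `|cofactor M k l| <= n.-1`!%:R * H ^+ n.-1.
Proof.
move=> Mi k; have Hij i j : row' k (col' l M) i j \is a Num.int /\
    `|row' k (col' l M) i j| <= H.
  by rewrite !mxE; apply: Mi; rewrite eq_sym neq_lift.
rewrite /cofactor; split.
  rewrite rpredM //; first by rewrite rpredX ?rpredN ?rpred1.
  by apply: det_int => i j; case: (Hij i j).
rewrite normrM normrX normrN1 expr1n mul1r.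
by apply: det_norm_le => i j; case: (Hij i j).
Qed.

(* The separating functional consists of the cofactors of [w] in a nonsingular
   square submatrix of [B] extended by the column [w]. *)
Lemma small_separating m n (B : 'M[K]_(m, n)) (w : 'cV[K]_m) (H : K) :
  1 <= H -> (forall i j, B i j \is a Num.int /\ `|B i j| <= H) ->
  ~~ (w^T <= B^T)%MS ->
  exists y : 'rV[K]_m, [/\ forall i, y 0 i \is a Num.int /\ `|y 0 i| <= m`!%:R * H ^+ m,
    y *m B = 0 & y *m w != 0].
Proof.
move=> H1 BH wB; have H0 : 0 <= H by apply: le_trans H1.
pose A := B^T; pose A1 := rowsub (maxrankfun A) A.
have freeA1 : row_free A1 := maxrowsub_free A.
pose r := \rank A.
have eqA1 : (A1 :=: A)%MS := eq_maxrowsub A.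
pose C := col_mx A1 w^T.
have rankC : \rank C = (r + 1)%N.
  have w0 : (w^T :&: A1 = 0)%MS.
    apply/eqP; rewrite -submx0; apply/rV_subP => u; rewrite sub_capmx => /andP[uw uA].
    have [c ec] := sub_rVP uw.
    case: (eqVneq c 0) => [c0|c0]; first by rewrite ec c0 scale0r sub0mx.
    case/negP: wB; rewrite -/A -eqA1.
    have -> : w^T = c^-1 *: u by rewrite ec scalerA mulVf // scale1r.
    exact: scalemx_sub.
  have := mxrank_sum_cap A1 w^T; rewrite capmxC w0 mxrank0 addn0 addsmxE => ->.
  congr (_ + _)%N; first exact/eqP.
  have wn0 : w^T != 0 by apply: contraNneq wB => ->; rewrite sub0mx.
  by rewrite rank_rV wn0.
have fullC : row_full C^T by rewrite /row_full mxrank_tr rankC.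
pose g := fullrankfun fullC.
pose F := rowsub g C^T.
have unitF : F \in unitmx by apply: fullrowsub_unit.
pose l : 'I_(r + 1) := rshift r ord0.
pose y' := row l (\adj F).
have y'F : y' *m F = \det F *: delta_mx 0 l.
  rewrite -row_mul mul_adj_mx; apply/rowP => j; rewrite !mxE eqxx /=.
  by rewrite eq_sym mulr_natr.
(* The rows of [C^T] were selected by [g]; the coefficients are carried back to all rows by summing
   over the fibres of [g]. *)
pose y := \row_t \sum_(k | g k == t) y' 0 k.
have yC : y *m C^T = y' *m F.
  apply/rowP => j; rewrite !mxE.
  rewrite [RHS](partition_big g xpredT) //=; apply: eq_bigr => t _.
  rewrite mxE mulr_suml; apply: eq_bigr => k /eqP <-.
  by rewrite !mxE.
have detF : \det F != 0 by rewrite -unitfE -unitmxE.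
have yA1 : y *m A1^T = 0.
  have : lsubmx (y *m C^T) = y *m A1^T.
    by rewrite /C tr_col_mx mul_mx_row row_mxKl.
  move=> <-; rewrite yC y'F; apply/rowP => j; rewrite !mxE.
  by rewrite eq_lrshift mulr0.
have yw : y *m w = (\det F)%:M.
  have : rsubmx (y *m C^T) = y *m w.
    by rewrite /C tr_col_mx mul_mx_row row_mxKr trmxK.
  move=> <-; rewrite yC y'F; apply/rowP => j; rewrite !mxE !ord1 !eqxx.
  by rewrite mulr1.
have rm : (r + 1 <= m)%N by rewrite -rankC rank_leq_col.
exists y; split; last first.
- rewrite yw; apply: contra detF => /eqP/matrixP/(_ 0 0); rewrite !mxE eqxx.
  by rewrite mulr1n => ->.
- have /submxP[X eX] : (A <= A1)%MS by rewrite eqA1.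
  by rewrite -[B]trmxK -/A eX trmx_mul mulmxA yA1 mul0mx.
have Fint i j : j != l -> F i j \is a Num.int /\ `|F i j| <= H.
  rewrite !mxE; case: splitP => [j' ej _|j' ej]; first by rewrite !mxE; apply: BH.
  by case/eqP; apply: val_inj; rewrite /= ej !ord1.
have y'small k : y' 0 k \is a Num.int /\ `|y' 0 k| <= r`!%:R * H ^+ r.
  by have := cofactor_small Fint k; rewrite !mxE {3 4}addn1.
move=> t; rewrite mxE; split.
  by apply: rpred_sum => k _; case: (y'small k).
apply: (le_trans (ler_norm_sum _ _ _)).
apply: (@le_trans _ _ (\sum_(k < r + 1) r`!%:R * H ^+ r)).
  rewrite big_mkcond /=; apply: ler_sum => k _; case: ifP => _.
    by case: (y'small k).
  by rewrite mulr_ge0 // exprn_ge0.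
rewrite sumr_const card_ord -mulrnAl -mulrnA -[(r`! * _)%N]mulnC addn1 -factS.
rewrite addn1 in rm.
apply: ler_pM; rewrite ?ler0n ?exprn_ge0 //.
  by rewrite ler_nat; apply: leq_fact.
by apply: ler_weXn2l => //; apply: ltnW.
Qed.

Section Spanning.

Variables (n : nat) (x : 'cV[K]_n) (Y : 'rV[K]_n -> K -> Prop) (H : K).
Hypothesis H1 : 1 <= H.
Hypothesis Y_small : forall a c, Y a c ->
  [/\ forall j, a 0 j \is a Num.int /\ `|a 0 j| <= H, c \is a Num.int & `|c| <= H].
Hypothesis Y_sol : forall a c, Y a c -> a *m x = c%:M.
Hypothesis Y_span : forall d : 'cV[K]_n, (forall a c, Y a c -> a *m d = 0) -> d = 0.

(** Greedy choice: fewer than [n] rows kill some nonzero [d], and an equation that does not kill [d]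
    is independent of them. *)
Lemma independent_rows r : (r <= n)%N ->
  exists (M : 'M[K]_(r, n)) (c : 'cV[K]_r),
    row_free M /\ forall i, Y (row i M) (c i 0).
Proof.
elim: r => [|r IH] rn.
  by exists 0, 0; split; [rewrite /row_free mxrank0|case].
have [M [c [freeM HM]]] := IH (ltnW rn).
have [d d0 Md] : exists2 d : 'cV[K]_n, d != 0 & M *m d = 0.
  have : cokermx M != 0.
    by rewrite -mxrank_eq0 mxrank_coker subn_eq0 -ltnNge (eqP freeM).
  case/matrix0Pn => i [j ij].
  exists (col j (cokermx M)).
    by apply: contraNneq ij => /colP/(_ i); rewrite !mxE => ->.
  by rewrite colE mulmxA mulmx_coker mul0mx.
have [a [b [Yab ad]]] : exists a b, Y a b /\ a *m d != 0.
  apply: contrapT => H'; case/eqP: d0; apply: Y_span => a b Yab.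
  by apply: contrapT => ad; apply: H'; exists a, b; split=> //; apply/eqP.
suff : exists (M' : 'M[K]_(1 + r, n)) (c' : 'cV[K]_(1 + r)),
  row_free M' /\ forall i, Y (row i M') (c' i 0) by [].
exists (col_mx a M), (col_mx b%:M c); split.
  rewrite -kermx_eq0; apply/eqP/row_matrixP => i; rewrite row0.
  pose u : 'rV[K]_(1 + r) := row i (kermx (col_mx a M)).
  change (u = 0).
  have uM : u *m col_mx a M = 0.
    by rewrite /u -row_mul mulmx_ker row0.
  move: uM; rewrite -(hsubmxK u); set u1 := lsubmx u; set u2 := rsubmx u.
  rewrite mul_row_col => uM.
  have u10 : u1 = 0.
    have : u1 *m a *m d = 0.
      have := congr1 (fun z => z *m d) uM.
      by rewrite mulmxDl -(mulmxA u2) Md mulmx0 addr0 mul0mx.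
    rewrite (mx11_scalar u1) -mulmxA mul_scalar_mx => /eqP.
    by rewrite scaler_eq0 (negbTE ad) orbF => /eqP ->; rewrite raddf0.
  have u20 : u2 = 0.
    move: uM; rewrite u10 mul0mx add0r => /eqP.
    by rewrite mulmx_free_eq0 // => /eqP.
  by rewrite u10 u20 row_mx0.
move=> i; rewrite mxE; case: splitP => j ej.
  have -> : i = lshift r j by apply: val_inj.
  by rewrite rowKu row_id mxE !ord1 eqxx mulr1n.
have -> : i = rshift 1 j by apply: val_inj.
by rewrite rowKd; apply: HM.
Qed.

Lemma cramer_small i : exists z1 z2 : K,
  [/\ z1 \is a Num.int /\ `|z1| <= n`!%:R * H ^+ n,
      z2 \is a Num.int /\ `|z2| <= n`!%:R * H ^+ n, z2 != 0 & x i 0 = z1 / z2].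
Proof.
have [M [c [freeM HM]]] := independent_rows (leqnn n).
have Msmall k j : M k j \is a Num.int /\ `|M k j| <= H.
  by have [/(_ j) + _ _] := Y_small (HM k); rewrite mxE.
have csmall k : c k 0 \is a Num.int /\ `|c k 0| <= H.
  by have [_ ? ?] := Y_small (HM k).
have Mx : M *m x = c.
  apply/colP => k; have := Y_sol (HM k); rewrite -row_mul => /rowP/(_ 0).
  by rewrite !mxE eqxx mulr1n => ->.
have dM : \det M != 0 by rewrite -unitfE -unitmxE -row_free_unit.
exists ((\adj M *m c) i 0), (\det M); split=> //; last first.
- by rewrite -Mx mulmxA mul_adj_mx mul_scalar_mx mxE mulrC mulKf.
- split; first by apply: det_int => k j; case: (Msmall k j).
  by apply: det_norm_le => k j; case: (Msmall k j).
have n0 : (0 < n)%N := leq_ltn_trans (leq0n _) (ltn_ord i).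
have Hcof k := @cofactor_small n M i H (fun k j _ => Msmall k j) k.
rewrite mxE; split.
  apply: rpred_sum => k _; rewrite mxE rpredM //; last by case: (csmall k).
  by case: (Hcof k).
apply: (le_trans (ler_norm_sum _ _ _)).
apply: (@le_trans _ _ (\sum_(k < n) (n.-1`!%:R * H ^+ n.-1) * H)).
  apply: ler_sum => k _; rewrite normrM mxE; apply: ler_pM => //.
    by case: (Hcof k).
  by case: (csmall k).
rewrite sumr_const card_ord -mulrA -exprSr prednK // -mulrnAl -mulrnA mulnC.
by rewrite -{1}(prednK n0) -factS prednK.
Qed.

End Spanning.

Lemma rat_of_quotient (z1 z2 : K) (H : nat) :
  z1 \is a Num.int -> z2 \is a Num.int -> z2 != 0 ->
  `|z1| <= H%:R -> `|z2| <= H%:R ->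
  exists q : rat, [/\ z1 / z2 = ratr q, (`|numq q| <= H)%N & (`|denq q| <= H)%N].
Proof.
move=> /intrP[a ->] /intrP[b ->]; rewrite intr_eq0 => b0.
rewrite -!intr_norm !pmulrn !ler_int => aH bH.
exists (a%:Q / b%:Q).
have e : (numq (a%:Q / b%:Q) * b = a * denq (a%:Q / b%:Q))%R.
  apply: (intr_inj (R := rat)); rewrite !rmorphM /= numqE.
  have b0' : b%:Q != 0 by rewrite intr_eq0.
  by field.
have cop := coprime_num_den (a%:Q / b%:Q).
have dn := congr1 absz e; rewrite !abszM in dn.
split.
- by rewrite rmorphM /= fmorphV /= !ratr_int.
- have [a0|a0] := eqVneq a 0; first by rewrite a0 mul0r.
  have : (`|numq (a%:Q / b%:Q)| %| `|a|)%N.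
    by rewrite -(Gauss_dvdl _ cop) -dn dvdn_mulr.
  by move/dvdn_leq => /(_ _); lia.
- have : (`|denq (a%:Q / b%:Q)| %| `|b|)%N.
    by rewrite -(Gauss_dvdr _ (n := `|numq (a%:Q / b%:Q)|)) 1?coprime_sym // dn dvdn_mull.
  by move/dvdn_leq => /(_ _); lia.
Qed.

End SmallIntegers.

Section SmallIntegersFin.

Variable K : realType.

Lemma sum_enum_val (T : finType) (F : T -> K) :
  \sum_(k < #|T|) F (enum_val k) = \sum_t F t.
Proof. by rewrite -(big_enum_val F). Qed.

(** Fredholm alternative with a small integral obstruction [y]. The solution [q] has no sign because
    it will be the direction of a perturbation. *)
Lemma small_separating_fin (J T : finType) (B : J -> T -> K) (w : J -> K) (H : K) :
  1 <= H -> (forall j t, B j t \is a Num.int /\ `|B j t| <= H) ->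
  (exists q : T -> K, forall j, \sum_t q t * B j t = w j) \/
  (exists y : J -> K,
    [/\ forall j, y j \is a Num.int /\ `|y j| <= (#|J|)`!%:R * H ^+ #|J|,
        forall t, \sum_j y j * B j t = 0 & \sum_j y j * w j != 0]).
Proof.
move=> H1 BH.
pose Bm := \matrix_(k < #|J|, l < #|T|) B (enum_val k) (enum_val l).
pose wm := \col_(k < #|J|) w (enum_val k).
case: (boolP (wm^T <= Bm^T)%MS) => [/submxP[X eX]|nw]; [left|right].
  exists (fun t => X 0 (enum_rank t)) => j.
  have /rowP/(_ (enum_rank j)) := eX; rewrite !mxE enum_rankK => ->.
  rewrite -sum_enum_val; apply: eq_bigr => l _.
  by rewrite !mxE enum_valK enum_rankK.
have [|y [ys yB yw]] := small_separating H1 _ nw.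
  by move=> k l; rewrite mxE; apply: BH.
exists (fun j => y 0 (enum_rank j)); split=> //.
- move=> t; have /rowP/(_ (enum_rank t)) := yB; rewrite !mxE => e.
  rewrite -[RHS]e -[LHS]sum_enum_val; apply: eq_bigr => k _.
  by rewrite !mxE enum_valK enum_rankK.
- apply: contraNneq yw => e; apply/eqP/rowP => k; rewrite !mxE -[RHS]e -[RHS]sum_enum_val.
  by apply: eq_bigr => l _; rewrite !mxE enum_valK.
Qed.

(** The hypothesis ranges over all small integer equations satisfied by [x], so no square system has
    to be named beforehand: a nonsingular one is found among them. *)
Lemma cramer_small_fin (T : finType) (x : T -> K) (H : K) : 1 <= H ->
  (forall d : T -> K,
     (forall (a : T -> K) (c : K), (forall t, a t \is a Num.int /\ `|a t| <= H) ->
        c \is a Num.int -> `|c| <= H -> \sum_t a t * x t = c -> \sum_t a t * d t = 0) ->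
     forall t, d t = 0) ->
  forall t, exists z1 z2 : K,
  [/\ z1 \is a Num.int /\ `|z1| <= (#|T|)`!%:R * H ^+ #|T|,
      z2 \is a Num.int /\ `|z2| <= (#|T|)`!%:R * H ^+ #|T|, z2 != 0 & x t = z1 / z2].
Proof.
move=> H1 span t.
pose xm := \col_(k < #|T|) x (enum_val k).
pose Y (a : 'rV[K]_#|T|) c := [/\ forall j, a 0 j \is a Num.int /\ `|a 0 j| <= H,
  c \is a Num.int /\ `|c| <= H & a *m xm = c%:M].
have [|||z1 [z2 [h1 h2 h3 h4]]] := @cramer_small K #|T| xm Y H _ _ _ (enum_rank t).
- by move=> a c [? [? ?] ?].
- by move=> a c [_ _ ?].
- move=> d Hd; apply/colP => k; rewrite mxE.
  have := span (fun u => d (enum_rank u) 0) _ (enum_val k); rewrite enum_valK; apply.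
  move=> a c aS cI cH eqn.
  have Yac : Y (\row_k a (enum_val k)) c.
    split=> //; first by move=> j; rewrite mxE.
    apply/rowP => j; rewrite !mxE !ord1 eqxx mulr1n -eqn -[RHS]sum_enum_val.
    by apply: eq_bigr => l _; rewrite !mxE.
  have /rowP/(_ 0) := Hd _ _ Yac; rewrite !mxE => e; rewrite -[RHS]e -[LHS]sum_enum_val.
  by apply: eq_bigr => l _; rewrite !mxE enum_valK.
by exists z1, z2; rewrite -h4 mxE enum_rankK.
Qed.

Lemma small_for_all (J : finType) (P : J -> K -> Prop) :
  (forall j, exists2 t0, 0 < t0 & forall t, `|t| <= t0 -> P j t) ->
  exists2 t0, 0 < t0 & forall t, `|t| <= t0 -> forall j, P j t.
Proof.
move=> H; have bad j : {t0 | 0 < t0 /\ forall t, `|t| <= t0 -> P j t}.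
  by apply: cid; have [t0 ? ?] := H j; exists t0.
exists (\big[Num.min/1]_j sval (bad j)).
  by apply: lt_bigmin => // j _; case: (svalP (bad j)).
move=> t tle j; have [_] := svalP (bad j); apply; apply: le_trans tle _.
exact: bigmin_le_cond.
Qed.

Lemma small_affine (a b : K) : 0 < a ->
  exists2 t0, 0 < t0 & forall t, `|t| <= t0 -> 0 <= a + t * b.
Proof.
move=> a0; have b1 : 0 < `|b| + 1 by rewrite ltr_wpDl.
exists (a / (`|b| + 1)); first exact: divr_gt0.
move=> t; rewrite ler_pdivlMr // => h.
have : `|t * b| <= a.
  by rewrite normrM; apply: le_trans h; rewrite ler_wpM2l // lerDl.
by rewrite ler_norml => /andP[? _]; lra.
Qed.

End SmallIntegersFin.

(** * Averages *)

Section Averages.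

Variable K : realType.

Lemma limn_einfE (u : nat -> \bar K) : limn_einf u = ereal_sup (range (einfs u)).
Proof.
rewrite limn_einf_lim; apply/cvg_lim => //.
by apply: ereal_nondecreasing_cvgn; apply: nondecreasing_einfs.
Qed.

Lemma einfs_le (u : nat -> \bar K) m n : (m <= n)%N -> (einfs u m <= u n)%E.
Proof. by move=> mn; apply: ereal_inf_lbound; exists n. Qed.

Variable f : nat -> K.

(** [mean_payoff] is convertible to an instance of this. The term at index 0 is [0 / 0 = 0], which a
    limit inferior ignores. *)
Definition avg_liminf : \bar K :=
  limn_einf (fun n : nat => ((\sum_(k < n) f k) / n%:R)%:E).

Lemma nat_above (x : K) : exists N : nat, x < N%:R.
Proof. by exists (Num.truncn `|x|).+1; apply: le_lt_trans (ler_norm x) (truncnS_gt _). Qed.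

Lemma avg_liminf_ge (x : K) :
  (forall d, 0 < d -> exists C, forall n, - (d * n%:R + C) <= \sum_(k < n) (f k - x)) ->
  (x%:E <= avg_liminf)%E.
Proof.
move=> Hf; apply/lee_addgt0Pr => d d0.
have [C HC] := Hf (d / 2) ltac:(lra).
have [N HN] := nat_above (`|C| / (d / 2)).
have h : ((x - d)%:E <= avg_liminf)%E.
  rewrite /avg_liminf limn_einfE.
  apply: (@le_trans _ _ (einfs (fun n : nat => ((\sum_(k < n) f k) / n%:R)%:E) N.+1));
    last by apply: ereal_sup_ubound; exists N.+1.
  apply: le_ereal_inf_tmp => _ [n /= Nn <-]; rewrite lee_fin.
  have n0 : 0 < n%:R :> K by rewrite ltr0n; lia.
  rewrite ler_pdivlMr //; have := HC n; rewrite sumrB sumr_const card_ord -mulr_natr.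
  have : N%:R <= n%:R :> K by rewrite ler_nat; lia.
  move: HN; rewrite ltr_pdivrMr ?divr_gt0 // => HN Nn' H.
  have := ler_norm C; nra.
by rewrite -leeBlDr // -EFinB.
Qed.

Lemma avg_liminf_le (x : K) :
  (forall d, 0 < d -> exists C, forall n, \sum_(k < n) (f k - x) <= d * n%:R + C) ->
  (avg_liminf <= x%:E)%E.
Proof.
move=> Hf; rewrite /avg_liminf limn_einfE; apply: ge_ereal_sup => _ [m _ <-].
apply/lee_addgt0Pr => d d0; rewrite -EFinD.
have [C HC] := Hf (d / 2) ltac:(lra).
have [N HN] := nat_above (`|C| / (d / 2)).
apply: (le_trans (einfs_le _ (_ : (m <= m + N.+1)%N))); first exact: leq_addr.
set n := (m + N.+1)%N; rewrite lee_fin.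
have n0 : 0 < n%:R :> K by rewrite ltr0n /n; lia.
rewrite ler_pdivrMr //; have := HC n; rewrite sumrB sumr_const card_ord -mulr_natr.
have : N%:R <= n%:R :> K by rewrite ler_nat /n; lia.
move: HN; rewrite ltr_pdivrMr ?divr_gt0 // => HN Nn' H.
have := ler_norm C; nra.
Qed.

Lemma avg_liminf_geP (x : K) : (x%:E <= avg_liminf)%E ->
  forall d, 0 < d -> exists N, forall n, (N <= n)%N -> (x - d) * n%:R <= \sum_(k < n) f k.
Proof.
rewrite /avg_liminf limn_einfE => Hx d d0.
have : ((x - d)%:E < ereal_sup (range (einfs
    (fun n : nat => ((\sum_(k < n) f k) / n%:R)%:E))))%E.
  by apply: lt_le_trans Hx; rewrite lte_fin; lra.
move=> /ereal_sup_gt[_ [N _ <-] HN]; exists N.+1 => n Nn.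
have n0 : 0 < n%:R :> K by rewrite ltr0n; lia.
have := lt_le_trans HN (einfs_le _ (ltnW Nn)); rewrite lte_fin ltr_pdivlMr //.
exact: ltW.
Qed.

(** An upper bound on a limit inferior only gives good dates arbitrarily late, whereas the lower
    bound of [avg_liminf_geP] holds from some date on. *)
Lemma avg_liminf_leP (x : K) : (avg_liminf <= x%:E)%E ->
  forall d, 0 < d -> forall N, exists2 n, (N < n)%N & \sum_(k < n) f k <= (x + d) * n%:R.
Proof.
rewrite /avg_liminf limn_einfE => Hx d d0 N.
have : (einfs (fun n : nat => ((\sum_(k < n) f k) / n%:R)%:E) N.+1 < (x + d)%:E)%E.
  apply: (@le_lt_trans _ _ x%:E); last by rewrite lte_fin; lra.
  by apply: le_trans Hx; apply: ereal_sup_ubound; exists N.+1.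
move=> /ereal_inf_lt[_ [n /= Nn <-] Hn]; exists n => //.
have n0 : 0 < n%:R :> K by rewrite ltr0n; lia.
by move: Hn; rewrite lte_fin ltr_pdivrMr // => /ltW.
Qed.

End Averages.

(** * From the arena to the negotiation function and back *)

Lemma steps_mkseq (Q X : finType) (A : Q * X -> {set X}) (S : sgraph Q X)
    (m : nat -> node S) (x : nat -> X) :
  (forall k, m k.+1 = nxt (m k) (x k)) ->
  (forall k, x k \in A (lab (m k), cho (m k))) -> forall n,
  allowed A (m 0%N) (mkseq x n) /\
  steps (m 0%N) (mkseq x n) = mkseq (fun k => (lab (m k), cho (m k), x k)) n.
Proof.
move=> Hm Hx n; elim: n m x Hm Hx => [|n IH] m x Hm Hx //=.
have [al st] := IH (fun k => m k.+1) (fun k => x k.+1) (fun k => Hm k.+1) (fun k => Hx k.+1).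
have mk (T : Type) (f : nat -> T) : [seq f i | i <- iota 1 n] = mkseq (fun k => f k.+1) n.
  by rewrite /mkseq (iotaDl 1 0) -map_comp.
by rewrite !mk Hx -Hm al st /mkseq /= mk.
Qed.

Lemma sum_mkseq (K : nmodType) (T : Type) (f : nat -> T) (F : T -> K) n :
  \sum_(t <- mkseq f n) F t = \sum_(j < n) F (f j).
Proof. by rewrite big_map -(big_mkord xpredT (fun j => F (f j))) /index_iota subn0. Qed.

Section Negotiation.

Variable G : mpgame.
Local Notation V := (vertex G).

(* A position is the current vertex together with the set of vertices visited
   since the last deviation of the challenger. *)
Definition position : finType := (V * {set V})%type.
Local Notation step := (position * V * V)%type.

Definition proposal_legal (q : position) (p : V) : bool := @edge G q.1 p.

Definition next_position (q : position) (p x : V) : position :=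
  (x, if x == p then x |: q.2 else [set x]).

Definition answers (i : player G) (s : position * V) : {set V} :=
  if owner s.1.1 == i then [set x | @edge G s.1.1 x] else [set s.2].

Definition deviation (t : step) : bool := t.2 != t.1.2.

Definition step_reward (j : player G) (t : step) : R := ratr (reward j t.1.1.1 t.2).

(* The value [-1] makes an infinite requirement impossible to satisfy. *)
Definition claim (lam : requirement G) (u : V) (t : step) : R :=
  if u \in t.1.1.2 then
    if lam u is x%:E then step_reward (owner u) t - x else -1
  else 0.

(** Claims are required only while no deviation occurs: a deviation resets the record, and
    consistency is asked of plays that follow the proposals. *)
Definition good_steps (lam : requirement G) (i : player G) (al d C : R)
    (s : seq step) : Prop :=
  \sum_(t <- s) (step_reward i t - al) <= d * (size s)%:R + C /\
  (all (predC deviation) s ->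
   forall u, - (d * (size s)%:R + C) <= \sum_(t <- s) claim lam u t).

Lemma good_steps_perm lam i al d C1 C2 s1 s2 s :
  good_steps lam i al d C1 s1 -> good_steps lam i al d C2 s2 ->
  perm_eq s (s1 ++ s2) -> good_steps lam i al d (C1 + C2) s.
Proof.
move=> [a1 b1] [a2 b2] pe; rewrite /good_steps (perm_size pe) (perm_all _ pe).
rewrite size_cat natrD (perm_big _ pe) /= big_cat /=; split; first by lra.
rewrite all_cat => /andP[/b1 c1 /b2 c2] u.
rewrite (perm_big _ pe) /= big_cat /=; have := c1 u; have := c2 u; lra.
Qed.

Section FromArena.

Variables (lam : requirement G) (v : V) (al : R) (S : sgraph position V) (m0 : node S).
Local Notation i := (owner v).
Hypothesis m0_lab : lab m0 = (v, [set v]).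
Hypothesis S_valid : sgraph_valid proposal_legal next_position (answers i) S.
Hypothesis S_win : winning (good_steps lam i al) (answers i) S.

Definition some_succ (w : V) : V := xchoose (@edge_total G w).

Definition node_after (h : seq V) : node S := foldl (@nxt _ _ S) m0 (behead h).

(** On histories that the graph does not follow any successor is played, which yields a strategy
    defined everywhere. *)
Definition arena_strat (h : seq V) : V :=
  if (lab (node_after h)).1 == last v h then cho (node_after h)
  else some_succ (last v h).

Definition tracked (h : seq V) : Prop :=
  [/\ h != [::], (lab (node_after h)).1 = last v h
    & last v h \in (lab (node_after h)).2].

Lemma arena_strat_is_strat j : is_strat j arena_strat.
Proof.
move=> h w _; rewrite /arena_strat last_rcons; case: eqP => [e|_].
  by rewrite -{1}e; apply: (S_valid.1 (node_after (rcons h w))).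
exact: (xchooseP (@edge_total G w)).
Qed.

Lemma node_after_rcons h x : h != [::] ->
  node_after (rcons h x) = nxt (node_after h) x.
Proof. by case: h => // y h _; rewrite /node_after /= foldl_rcons. Qed.

Lemma tracked_rcons h x : tracked h ->
  x \in answers i (lab (node_after h), cho (node_after h)) -> tracked (rcons h x).
Proof.
move=> [h0 l1 l2] xA; rewrite /tracked node_after_rcons // S_valid.2 //.
rewrite last_rcons /=; split=> //; first by case: (h).
by case: ifP => _; rewrite !inE eqxx.
Qed.

(** The same strategy serves every player: for [i] it means accepting each proposal, and this is the
    witness of rationality. *)
Definition arena_profile : profile G := fun=> arena_strat.

Lemma tracked_cho h : tracked h -> arena_strat h = cho (node_after h).
Proof. by move=> [_ e _]; rewrite /arena_strat e eqxx. Qed.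

Lemma tracked_answer h x : tracked h ->
  (owner (last v h) == i -> @edge G (last v h) x) ->
  (owner (last v h) != i -> x = arena_strat h) ->
  x \in answers i (lab (node_after h), cho (node_after h)).
Proof.
move=> th; have [_ e _] := th; rewrite -e /answers /=; case: eqP => _ H1 H2.
  by rewrite inE H1.
by rewrite inE H2 // tracked_cho.
Qed.

Lemma compat_tracked s : compat arena_profile i v s -> tracked s.
Proof.
move=> [s' [-> [ps' H]]] {s}.
elim/last_ind: s' ps' H => [|s' x IH] ps' H.
  by rewrite /tracked /node_after /= m0_lab inE eqxx.
move: ps'; rewrite rcons_path => /andP[ps' ex].
have th : tracked (v :: s').
  apply: IH => // k ks kown.
  have := H k; rewrite -rcons_cons size_rcons !nth_rcons ks (ltnW ks) => -> //.
    by rewrite -cats1 takel_cat // ltnW.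
  exact: ltnW.
rewrite -rcons_cons; apply: tracked_rcons => //; apply: tracked_answer => //= own.
have e1 : nth v (v :: rcons s' x) (size s') = last v s'.
  by rewrite -rcons_cons nth_rcons /= ltnSn (last_nth v).
have e2 : nth v (v :: rcons s' x) (size s').+1 = x by rewrite /= nth_rcons ltnn eqxx.
have e3 : take (size s').+1 (v :: rcons s' x) = v :: s'.
  by rewrite /= -cats1 take_size_cat.
by rewrite -e2 H ?e1 ?e3 //= size_rcons.
Qed.

Section Outcome.
Variables (s : strat G) (h : seq V) (w : V).
Hypothesis s_strat : is_strat i s.
Hypothesis hw : tracked (rcons h w).

Let sigma := upd arena_profile i s.
Let hist n := h ++ run sigma h w n.
Let mv n := sigma (owner (last w (run sigma h w n))) (hist n).
Let nd n := node_after (hist n).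

Lemma run_neq0 n : run sigma h w n != [::].
Proof. by case: n => //= n; case: run. Qed.

Lemma hist_last n : last v (hist n) = outcome sigma h w n.
Proof. by rewrite /hist last_cat /outcome; case: run (run_neq0 n). Qed.

Lemma outcome_succ n : outcome sigma h w n.+1 = mv n.
Proof. by rewrite /outcome /= last_rcons. Qed.

Lemma hist_succ n : hist n.+1 = rcons (hist n) (mv n).
Proof. by rewrite /hist /= rcons_cat. Qed.

Lemma hist_spec n : tracked (hist n) /\
  mv n \in answers i (lab (nd n), cho (nd n)).
Proof.
have main m : tracked (hist m) -> mv m \in answers i (lab (nd m), cho (nd m)).
  move=> th; apply: tracked_answer => //; rewrite hist_last /mv /sigma /upd -/sigma.
    rewrite -/(outcome sigma h w m) => /[dup] own ->.
    have := hist_last m; case/lastP: (hist m) (th) => [[]//|h' w' _].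
    by rewrite last_rcons => e; rewrite -e; apply: s_strat; rewrite e; apply/eqP.
  by rewrite -/(outcome sigma h w m) => /negbTE ->.
elim: n => [|n [th mA]].
  have th : tracked (hist 0) by rewrite /hist /= cats1.
  by split=> //; apply: main.
suff th' : tracked (hist n.+1) by split=> //; apply: main.
by rewrite hist_succ; apply: tracked_rcons.
Qed.

Lemma nd_succ n : nd n.+1 = nxt (nd n) (mv n).
Proof. by rewrite /nd hist_succ node_after_rcons //; case: (hist_spec n) => [[]]. Qed.

Lemma nd_lab n : (lab (nd n)).1 = outcome sigma h w n.
Proof. by rewrite -hist_last; case: (hist_spec n) => [[]]. Qed.

Lemma outcome_good n d : 0 < d -> exists C, forall k,
  good_steps lam i al d C (mkseq (fun j =>
    (lab (nd (n + j)%N), cho (nd (n + j)%N), mv (n + j)%N)) k).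
Proof.
move=> d0; have [C HC] := S_win (nd n) d0; exists C => k.
have [|j|al' st] := @steps_mkseq _ _ (answers i) S (fun j => nd (n + j)%N)
  (fun j => mv (n + j)%N) _ _ k.
- by move=> j; rewrite addnS nd_succ.
- exact: (hist_spec _).2.
by rewrite -st addn0; apply: HC; rewrite -{1}(addn0 n).
Qed.

Lemma outcome_upper : (mean_payoff i (outcome sigma h w) <= al%:E)%E.
Proof.
apply: (@avg_liminf_le _ (fun k =>
  ratr (reward i (outcome sigma h w k) (outcome sigma h w k.+1)))) => d d0.
have [C HC] := outcome_good 0 d0; exists C => n.
have [+ _] := HC n; rewrite size_mkseq sum_mkseq.
by under eq_bigr do rewrite /step_reward /= nd_lab -outcome_succ.
Qed.

End Outcome.

Lemma arena_consistent h w : compat arena_profile i v (rcons h w) ->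
  lam_consistent lam (outcome (upd arena_profile i arena_strat) h w).
Proof.
move=> /compat_tracked hw n.
set sigma := upd _ _ _.
have sE : sigma = arena_profile.
  by apply: funext => j; rewrite /sigma /upd; case: ifP.
pose hist n := h ++ run sigma h w n.
pose mv n := sigma (owner (last w (run sigma h w n))) (hist n).
pose nd n := node_after (hist n).
have spec k : tracked (hist k) /\ mv k \in answers i (lab (nd k), cho (nd k)).
  exact: hist_spec (@arena_strat_is_strat i) hw k.
have mvE k : mv k = cho (nd k).
  by rewrite /mv sE /arena_profile tracked_cho //; case: (spec k).
have ndS k : nd k.+1 = nxt (nd k) (mv k).
  exact: nd_succ (@arena_strat_is_strat i) hw k.
have ndL k : (lab (nd k)).1 = outcome sigma h w k.
  exact: nd_lab (@arena_strat_is_strat i) hw k.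
have outS k : outcome sigma h w k.+1 = mv k by apply: outcome_succ.
set u := outcome sigma h w n.
(* From here on every proposal is accepted, so the record only grows and keeps [u]. *)
have uW k : u \in (lab (nd (n + k)%N)).2.
  elim: k => [|k IH].
    by rewrite addn0 /u -hist_last; case: (spec n) => [[]].
  rewrite addnS ndS S_valid.2; last by case: (spec (n + k)%N).
  by rewrite mvE /= eqxx inE IH orbT.
have bound d : 0 < d -> exists C, forall k, - (d * k%:R + C) <=
    \sum_(j < k) claim lam u (lab (nd (n + j)%N), cho (nd (n + j)%N), mv (n + j)%N).
  move=> d0; have [C HC] : exists C, forall k, good_steps lam i al d C
      (mkseq (fun j => (lab (nd (n + j)%N), cho (nd (n + j)%N), mv (n + j)%N)) k).
    have [C HC] := outcome_good (@arena_strat_is_strat i) hw n d0.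
    by exists C => k; exact: (HC k).
  exists C => k; have [_] := HC k; rewrite size_mkseq.
  rewrite all_map; set P := all _ _; have -> : P.
    by apply/allP => j _ /=; rewrite /deviation /= mvE eqxx.
  move=> /(_ isT u).
  by rewrite sum_mkseq.
rewrite /claim /= in bound.
case Eu: (lam u) bound => [x| |] bound; last exact: leNye.
- apply: (@avg_liminf_ge _ (fun k => ratr (reward (owner u)
    (outcome sigma h w (n + k)) (outcome sigma h w (n + k.+1))))) => d d0.
  have [C HC] := bound d d0; exists C => k; move: (HC k).
  under eq_bigr do rewrite uW /step_reward /= ndL.
  by under [in X in _ -> X]eq_bigr do rewrite addnS outS.
(* An infinite requirement contributes [-1] at each step, which a lower bound of rate [1 / 2]
   excludes. *)
- exfalso; clear Eu; have [C HC] := bound (1 / 2) ltac:(lra).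
  have [N HN] := nat_above (2 * C).
  have := HC N; under eq_bigr do rewrite uW.
  rewrite sumr_const card_ord mulNrn; lra.
Qed.

Lemma nego_le_arena : (nego lam v <= al%:E)%E.
Proof.
apply: (@le_trans _ _ (ereal_sup [set mean_payoff i
    (outcome (upd arena_profile i s) [::] v) | s in is_strat i]%classic)).
  apply: ereal_inf_lbound; exists arena_profile => //; split.
    by move=> j _; apply: arena_strat_is_strat.
  exists arena_strat; split; first exact: arena_strat_is_strat.
  by move=> h w; apply: arena_consistent.
apply: ge_ereal_sup => _ [s sS <-]; apply: outcome_upper => //.
by rewrite /tracked /node_after /= m0_lab inE eqxx.
Qed.

End FromArena.

End Negotiation.

(** * From rational profiles to plays of the arena *)

Section ToArena.

Variables (G : mpgame) (lam : requirement G) (v : vertex G) (tau : profile G).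
Variables (s : strat G) (c : position G * vertex G -> vertex G).
Local Notation V := (vertex G).
Local Notation i := (owner v).
Hypothesis tau_strat : forall j, j != i -> is_strat j (tau j).
Hypothesis s_strat : is_strat i s.
Hypothesis s_cons : forall (h : seq V) (w : V), compat tau i v (rcons h w) ->
  lam_consistent lam (outcome (upd tau i s) h w).
Hypothesis cA : forall t, c t \in answers i t.

Let sigma := upd tau i s.

(** The profile, with [s] for [i], proposes and [c] answers. The history is what the profile sees,
    the position what [c] sees. *)
Fixpoint against (n : nat) : seq V * position G :=
  if n is n'.+1 then
    let: (h, q) := against n' in
    let p := sigma (owner q.1) h in
    let x := c (q, p) in (rcons h x, next_position q p x)
  else ([:: v], (v, [set v])).

Let hist n := (against n).1.
Let pos n := (against n).2.
Let prop n := sigma (owner (pos n).1) (hist n).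
Let ans n := c (pos n, prop n).

Definition against_step n : position G * V * V := (pos n, prop n, ans n).

Lemma hist_S n : hist n.+1 = rcons (hist n) (ans n).
Proof. by rewrite /hist /ans /prop /pos /hist /=; case: (against n). Qed.

Lemma pos_S n : pos n.+1 = next_position (pos n) (prop n) (ans n).
Proof. by rewrite /ans /prop /pos /hist /=; case: (against n). Qed.

Lemma hist_pos n : last v (hist n) = (pos n).1.
Proof. by case: n => [|n] //; rewrite hist_S last_rcons pos_S. Qed.

Lemma hist_rcons n : exists h, hist n = rcons h (pos n).1.
Proof. by case: n => [|n]; [exists [::]|exists (hist n); rewrite hist_S pos_S]. Qed.

Lemma size_hist n : size (hist n) = n.+1.
Proof. by elim: n => // n IH; rewrite hist_S size_rcons IH. Qed.

Lemma take_hist n k : (k <= n)%N -> take k.+1 (hist n) = hist k.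
Proof.
elim: n => [|n IH]; first by rewrite leqn0 => /eqP->.
rewrite leq_eqVlt => /predU1P[->|]; first by rewrite take_oversize ?size_hist.
by rewrite ltnS => kn; rewrite hist_S -cats1 takel_cat ?size_hist // IH.
Qed.

Lemma nth_hist n k : (k <= n)%N -> nth v (hist n) k = (pos k).1.
Proof.
by move=> kn; rewrite -hist_pos -(take_hist kn) -(nth_take v (ltnSn k))
  -nth_last size_take size_hist ltnS; case: ltngtP kn => // ->.
Qed.

Lemma sigma_strat j : is_strat j (sigma j).
Proof. by rewrite /sigma /upd; case: eqVneq => [->|/tau_strat]. Qed.

Lemma prop_legal n : proposal_legal (pos n) (prop n).
Proof.
rewrite /proposal_legal /prop; have [h ->] := hist_rcons n.
exact: sigma_strat.
Qed.

Lemma ans_edge n : @edge G (pos n).1 (ans n).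
Proof.
have := cA (pos n, prop n); rewrite -/(ans n) /answers /=.
by case: ifP => _; rewrite inE // => /eqP->; apply: prop_legal.
Qed.

(** Only one play matters, so the answers of [c] are read off its prefixes by their length, without
    reconstructing the position from the history. *)
Definition against_strat (h : seq V) : V :=
  if h == hist (size h).-1 then ans (size h).-1 else some_succ (last v h).

Lemma against_strat_is_strat : is_strat i against_strat.
Proof.
move=> h w own; rewrite /against_strat last_rcons; case: eqP => [e|_].
  have := hist_pos (size (rcons h w)).-1; rewrite -e last_rcons => {1}->.
  exact: ans_edge.
exact: (xchooseP (@edge_total G w)).
Qed.

Lemma run_against n : run (upd tau i against_strat) [::] v n = hist n.
Proof.
elim: n => // n IH; rewrite hist_S /= IH hist_pos; congr rcons.
rewrite /upd; case: eqVneq => [own|own].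
  by rewrite /against_strat size_hist eqxx.
have := cA (pos n, prop n); rewrite -/(ans n) /answers /= (negbTE own) inE => /eqP->.
by rewrite /prop /sigma /upd (negbTE own).
Qed.

Lemma outcome_against :
  outcome (upd tau i against_strat) [::] v = fun n => (source (against_step n)).1.
Proof. by apply: funext => n; rewrite /outcome run_against hist_pos. Qed.

Lemma compat_hist n : compat tau i v (hist n).
Proof.
case E: (hist n) => [|w h]; first by have := size_hist n; rewrite E.
have wv : w = v by have := nth_hist (leq0n n); rewrite E.
rewrite wv in E *; exists h; split=> //; split.
  apply/(pathP v) => k kh.
  have kn : (k < n)%N by have := size_hist n; rewrite E /= => -[<-].
  have := nth_hist (ltnW kn); rewrite E => ->.
  have := nth_hist kn; rewrite E /= => ->.
  by rewrite pos_S /=; apply: ans_edge.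
rewrite -E => k; rewrite size_hist ltnS => kn.
rewrite !nth_hist ?(ltnW kn) // pos_S /= => own.
have := cA (pos k, prop k); rewrite -/(ans k) /answers /= (negbTE own) inE => /eqP->.
by rewrite /prop /sigma /upd (negbTE own) take_hist // ltnW.
Qed.

(** Once deviations have ceased, the play is the outcome of the full profile after [hist T], a
    history compatible with [tau], so rationality applies. *)
Lemma against_consistent T : (forall k, (T <= k)%N -> ~~ deviation (against_step k)) ->
  forall n, (T <= n)%N -> (lam (source (against_step n)).1 <=
    mean_payoff (owner (source (against_step n)).1)
      (fun k => (source (against_step (n + k)%N)).1))%E.
Proof.
move=> nodev n Tn; have [h hT] := hist_rcons T.
have runE m : h ++ run sigma h (pos T).1 m = hist (T + m)%N.
  elim: m => [|m IH]; first by rewrite addn0 hT /= cats1.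
  rewrite addnS hist_S /= -rcons_cat IH; congr rcons.
  have -> : last (pos T).1 (run sigma h (pos T).1 m) = (pos (T + m)%N).1.
    rewrite -(hist_pos (T + m)) -IH last_cat; case: run (IH) => //= /(congr1 size).
    by rewrite cats0 size_hist => sh; have := size_hist T; rewrite hT size_rcons; lia.
  have := nodev (T + m)%N (leq_addr _ _).
  by rewrite /deviation negbK /= => /eqP.
have outE m : outcome sigma h (pos T).1 m = (pos (T + m)%N).1.
  rewrite -(hist_pos (T + m)) -runE last_cat /outcome; case E: run => //.
  by case: m E => //= m; case: run.
have := compat_hist T; rewrite hT => /s_cons /(_ (n - T)%N); rewrite -/sigma outE.
rewrite subnKC //; congr (_ <= mean_payoff _ _)%E.
by apply: funext => k; rewrite outE /source /= addnA subnKC.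
Qed.

End ToArena.

Lemma play_of_rational (G : mpgame) (lam : requirement G) (v : vertex G)
    (tau : profile G) (c : position G * vertex G -> vertex G) :
  lam_rat lam v tau -> (forall t, c t \in answers (owner v) t) ->
  exists e : nat -> position G * vertex G * vertex G,
  [/\ source (e 0%N) = (v, [set v]),
      forall n, [/\ proposal_legal (source (e n)) (e n).1.2, (e n).2 = c (e n).1
        & source (e n.+1) = target (@next_position G) (e n)],
      (exists2 s, is_strat (owner v) s & outcome (upd tau (owner v) s) [::] v =
         fun n => (source (e n)).1)
    & forall T, (forall k, (T <= k)%N -> ~~ deviation (e k)) ->
      forall n, (T <= n)%N -> (lam (source (e n)).1 <=
        mean_payoff (owner (source (e n)).1) (fun k => (source (e (n + k)%N)).1))%E].
Proof.
move=> [tauS [s [sS sC]]] cA; exists (against_step v tau s c); split=> //.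
- move=> n; split=> //; first exact: prop_legal.
  by rewrite /source /target /= -pos_S.
- exists (against_strat v tau s c); first exact: against_strat_is_strat.
  exact: outcome_against.
- by move=> T; apply: against_consistent.
Qed.

(** * Certificates *)

Lemma inf_often_set (E : finType) (e : nat -> E) : exists (I : {set E}) (T0 : nat),
  (forall k, (T0 <= k)%N -> e k \in I) /\
  forall x, x \in I -> forall k, exists2 k', (k <= k')%N & e k' = x.
Proof.
pose inf x := forall k, exists2 k', (k <= k')%N & e k' = x.
have last_time x : {T | ~ inf x -> forall k, (T <= k)%N -> e k <> x}.
  apply: cid; have [Hx|Hx] := pselect (inf x); first by exists 0%N.
  have /existsNP[T HT] := Hx; exists T => _ k Tk ek.
  by apply: HT; exists k.
exists [set x | `[< inf x >]], (\max_x sval (last_time x)); split.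
  move=> k kT; rewrite inE; apply/asboolP; apply: contrapT => Hk.
  apply: (svalP (last_time (e k)) Hk k) => //.
  by apply: leq_trans kT; apply: (leq_bigmax (e k)).
by move=> x; rewrite inE => /asboolP.
Qed.

(** If every index failed at some precision, the smallest of these precisions would have no index
    left. This will fix one set of recurrent steps for all precisions. *)
Lemma finite_pigeonhole (K : realType) (J : finType) (P : K -> J -> Prop) :
  (forall d d' j, P d j -> d <= d' -> P d' j) ->
  (forall d, 0 < d -> exists j, P d j) -> exists j, forall d, 0 < d -> P d j.
Proof.
move=> Pmono Pex; apply: contrapT => noj.
have bad j : {d | 0 < d /\ ~ P d j}.
  apply: cid; apply: contrapT => H; apply: noj; exists j => d d0.
  by apply: contrapT => nP; apply: H; exists d.
pose d0 : K := \big[Num.min/1]_j sval (bad j).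
have d0_gt0 : 0 < d0.
  by apply: lt_bigmin => // j _; case: (svalP (bad j)).
have [j Pj] := Pex d0 d0_gt0.
have [_] := svalP (bad j); apply; apply: Pmono Pj _.
exact: bigmin_le_cond.
Qed.

Lemma small_for_large (K : realType) (A d : K) : 0 < d ->
  exists N : nat, forall M : nat, (N < M)%N -> A <= d * M%:R.
Proof.
move=> d0; have [N HN] := nat_above (A / d); exists N => M NM.
move: HN; rewrite ltr_pdivrMr // mulrC => HN; apply: (le_trans (ltW HN)).
by rewrite ler_pM2l // ler_nat ltnW.
Qed.

Lemma finite_eventually (J : finType) (P : J -> nat -> Prop) :
  (forall j, exists N : nat, forall M, (N < M)%N -> P j M) ->
  exists N : nat, forall j M, (N < M)%N -> P j M.
Proof.
move=> /choice[N HN]; exists (\max_j N j) => j M NM; apply: HN.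
by apply: leq_ltn_trans NM; apply: leq_bigmax.
Qed.

Lemma avg_liminf_tail_ge (K : realType) (f : nat -> K) (n : nat) (x : K) :
  (x%:E <= avg_liminf (fun k => f (n + k)%N))%E -> forall d, 0 < d ->
  exists N : nat, forall M, (N < M)%N -> (x - d) * M%:R <= \sum_(k < M) f k.
Proof.
move=> Hx d d0; have [N1 HN1] := avg_liminf_geP Hx (d := d / 2) ltac:(lra).
pose A := \sum_(k < n) f k.
have [N2 HN2] := @small_for_large K ((x - d / 2) * n%:R - A) (d / 2) ltac:(lra).
exists (N1 + N2 + n)%N => M NM.
have -> : \sum_(k < M) f k = A + \sum_(k < M - n) f (n + k)%N.
  have h m : \sum_(k < n + m) f k = A + \sum_(k < m) f (n + k)%N.
    by rewrite big_split_ord.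
  by have := h (M - n)%N; rewrite subnKC //; lia.
have := HN1 (M - n)%N ltac:(lia); have := HN2 M ltac:(lia).
rewrite natrB; [nra|lia].
Qed.

Section Certificates.

Variable G : mpgame.
Local Notation V := (vertex G).
Local Notation step := (position G * V * V)%type.
Local Notation tgt := (target (@next_position G)).
Local Notation src := (@source (position G) V).

(** If a deviation recurs in [I], the play never settles into an outcome of the profile, and no
    requirement binds it. *)
Definition claims (I : {set step}) (u : V) : bool :=
  [forall (t | t \in I), ~~ deviation t] && [exists t in I, u \in t.1.1.2].

Record arena_play (v : V) (c : position G * V -> V) (I : {set step})
    (e : nat -> step) (T0 : nat) : Prop := ArenaPlay {
  play_init : src (e 0%N) = (v, [set v]);
  play_legal : forall n, proposal_legal (src (e n)) (e n).1.2;
  play_answer : forall n, (e n).2 = c (e n).1;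
  play_step : forall n, src (e n.+1) = tgt (e n);
  play_tail : forall k, (T0 <= k)%N -> e k \in I;
  play_inf : forall t, t \in I -> forall k, exists2 k', (k <= k')%N & e k' = t }.

Local Notation cyc I := (cycle_in src tgt I).

(** Linear in [p], with [al] and the values of [lam] on the right-hand sides: moving [lam] moves
    only the right-hand sides. *)
Definition certifies (lam : requirement G) (v : V) (al : R) (I : {set step})
    (p : cyc I -> R) : Prop :=
  [/\ forall C, 0 <= p C, mean p (fun=> 1) = 1, mean p (step_reward (owner v)) <= al
    & forall u, claims I u -> exists2 x, lam u = x%:E & x <= mean p (step_reward (owner u))].

(** Without deviations the record is nondecreasing, and recurrence brings each of its values back,
    so it is constant. *)
Lemma visited_const v c I e T0 : arena_play v c I e T0 ->
  [forall (t | t \in I), ~~ deviation t] ->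
  forall t t', t \in I -> t' \in I -> t.1.1.2 = t'.1.1.2.
Proof.
move=> [_ _ _ St tail inf] /forall_inP nodev.
have mono k n : (T0 <= k)%N -> (e k).1.1.2 \subset (e (k + n)%N).1.1.2.
  move=> Tk; elim: n => [|n IH]; first by rewrite addn0.
  rewrite addnS; have := St (k + n)%N; rewrite /source => ->.
  have /nodev : e (k + n)%N \in I by apply: tail; lia.
  rewrite /target /deviation negbK /= => ->.
  by apply: (fintype.subset_trans IH); apply: finset.subsetUr.
have incl t t' : t \in I -> t' \in I -> t.1.1.2 \subset t'.1.1.2.
  move=> tI t'I; have [k Tk <-] := inf t tI T0.
  have [k' kk' <-] := inf t' t'I k.
  by rewrite -(subnKC kk'); apply: mono.
by move=> t t' tI t'I; apply/eqP; rewrite finset.eqEsubset !incl.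
Qed.

Lemma mean_le (I : {set step}) (p : cyc I -> R) g g' : (forall C, 0 <= p C) ->
  (forall t, t \in I -> g t <= g' t) -> mean p g <= mean p g'.
Proof.
move=> p0 gg; apply: ler_sum => C _; apply: ler_wpM2l => //.
rewrite /weight big_seq_cond [leRHS]big_seq_cond; apply: ler_sum => t /andP[tC _].
by apply: gg; case/andP: (valP C) => _ /allP; apply.
Qed.

Lemma meanB (I : {set step}) (p : cyc I -> R) g (x : R) :
  mean p (fun=> 1) = 1 -> mean p (fun t => g t - x) = mean p g - x.
Proof.
move=> p1; rewrite -[x in RHS]mul1r -p1 /mean mulr_suml -sumrB; apply: eq_bigr => C _.
rewrite -mulrA -mulrBr /weight sumrB; congr (_ * (_ - _)).
by rewrite mulr_suml; apply: eq_bigr => t _; rewrite mul1r.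
Qed.

Lemma certificate_wins lam v al c I e T0 (p : cyc I -> R) :
  arena_play v c I e T0 -> certifies lam v al p ->
  wins (@proposal_legal G) (@next_position G) (good_steps lam (owner v) al)
    (fun s => [set c s]) (v, [set v]).
Proof.
move=> play [p0 p1 p_up p_low].
have [init legal answ St tail inf] := play.
have [e' [[St' init'] old tail' inf' freq]] :=
  cycles_realizable (src := src) (tgt := tgt) St tail inf p0 p1.
rewrite -init -init'; apply: wins_play => //.
- by move=> n; have [k ->] := old n.
- by move=> n; have [k ->] := old n.
have seg (g : step -> R) m n : \sum_(t <- mkseq (fun k => e' (m + k)%N) n) g t =
    \sum_(k < m + n) g (e' k) - \sum_(k < m) g (e' k).
  by rewrite sum_mkseq big_split_ord /= addrC addrK.
move=> m d d0.
have [C0 HC0] := freq (fun t => step_reward (owner v) t - al) d d0.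
pose A0 := \sum_(k < m) (step_reward (owner v) (e' k) - al).
have up n : \sum_(t <- mkseq (fun k => e' (m + k)%N) n) (step_reward (owner v) t - al)
    <= d * n%:R + (d * m%:R + C0 - A0).
  rewrite seg -/A0; have := HC0 (m + n)%N; rewrite meanB // ler_norml => /andP[_].
  have : (m + n)%:R * (mean p (step_reward (owner v)) - al) <= 0.
    by rewrite mulr_ge0_le0 // subr_le0.
  rewrite natrD; lra.
have low u : exists Cu, forall n,
    all (predC (@deviation G)) (mkseq (fun k => e' (m + k)%N) n) ->
    - (d * n%:R + Cu) <= \sum_(t <- mkseq (fun k => e' (m + k)%N) n) claim lam u t.
  (* A recurrent deviation bounds the length of the deviation-free segments from [m], so a constant
     suffices. Otherwise the record is constant and the mean of each claim is nonnegative. *)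
  have [nodev|/forallPn[t]] := boolP [forall (t | t \in I), ~~ deviation t]; last first.
    rewrite negb_imply negbK => /andP[tI devt].
    have [k mk ek] := inf' t tI m.
    pose B := \sum_t `|claim lam u t|.
    exists (B * k%:R) => n nd.
    have nk : (n <= k)%N.
      rewrite leqNgt; apply/negP => kn; move/allP: nd => /(_ t) /=.
      rewrite devt => /(_ _)/negP; apply=> //; apply/mapP; exists (k - m)%N.
        by rewrite mem_iota; lia.
      by rewrite subnKC.
    have := @sum_normB R _ (claim lam u) (mkseq (fun k => e' (m + k)%N) n).
    rewrite size_mkseq -/B ler_norml => /andP[+ _]; apply: le_trans.
    have B0 : 0 <= B by apply: sumr_ge0.
    have : B * n%:R <= B * k%:R by rewrite ler_wpM2l // ler_nat.
    have : 0 <= d * n%:R by rewrite mulr_ge0 // ltW.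
    lra.
  have [Cu HCu] := freq (claim lam u) d d0.
  pose Au := \sum_(k < m) claim lam u (e' k).
  have mean_ge0 : 0 <= mean p (claim lam u).
    have [cl|ncl] := boolP (claims I u).
      have [x lamx xle] := p_low u cl.
      apply: (@le_trans _ _ (mean p (fun t => step_reward (owner u) t - x))).
        by rewrite meanB // subr_ge0.
      apply: mean_le => // t tI; rewrite /claim lamx.
      move: cl => /andP[_ /exists_inP[t' t'I ut']].
      by rewrite (visited_const play nodev tI t'I) ut'.
    rewrite -[leLHS](_ : mean p (fun=> 0) = 0); last first.
      by rewrite /mean big1 // => C _; rewrite /weight big1 ?mulr0.
    apply: mean_le => // t tI; rewrite /claim ifN //.
    by apply: contra ncl => ut; rewrite /claims nodev; apply/exists_inP; exists t.
  exists (d * m%:R + Cu + Au) => n _; rewrite seg -/Au.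
  have := HCu (m + n)%N; rewrite ler_norml => /andP[+ _].
  have : 0 <= (m + n)%:R * mean p (claim lam u) by rewrite mulr_ge0.
  rewrite natrD; lra.
have [Cu HCu] := choice low.
exists (`|d * m%:R + C0 - A0| + \sum_u `|Cu u|) => n.
have Cu0 : 0 <= \sum_u `|Cu u| by apply: sumr_ge0.
rewrite -/(mkseq (fun k => e' (m + k)%N) n) /good_steps size_mkseq; split.
  by have := up n; have := ler_norm (d * m%:R + C0 - A0); lra.
move=> nd u; have := HCu u n nd; have := ler_norm (Cu u).
have : `|Cu u| <= \sum_u `|Cu u| by rewrite (bigD1 u) //= lerDl sumr_ge0.
have := normr_ge0 (d * m%:R + C0 - A0); lra.
Qed.

Lemma mean_payoff_bounded (j : player G) : exists B : R, forall rho : nat -> V,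
  ((- B)%:E <= mean_payoff j rho <= B%:E)%E.
Proof.
pose B : R := \sum_a \sum_b `|ratr (reward j a b)|.
exists B => rho; have rB a b : `|ratr (reward j a b) : R| <= B.
  rewrite /B (bigD1 a) //= (bigD1 b) //= -addrA lerDl addr_ge0 ?sumr_ge0 // => ? _.
  exact: sumr_ge0.
apply/andP; split.
  apply: (@avg_liminf_ge _ (fun k => ratr (reward j (rho k) (rho k.+1)))) => d d0.
  exists 0 => n; apply: (@le_trans _ _ 0).
    by rewrite oppr_le0 addr0 mulr_ge0 // ltW.
  by apply: sumr_ge0 => k _; have := rB (rho k) (rho k.+1); rewrite ler_norml; lra.
apply: (@avg_liminf_le _ (fun k => ratr (reward j (rho k) (rho k.+1)))) => d d0.
exists 0 => n; apply: (@le_trans _ _ 0); last by rewrite addr0 mulr_ge0 // ltW.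
by apply: sumr_le0 => k _; have := rB (rho k) (rho k.+1); rewrite ler_norml; lra.
Qed.

Lemma visited_since v (e : nat -> step) :
  src (e 0%N) = (v, [set v]) -> (forall n, src (e n.+1) = tgt (e n)) ->
  forall k u, u \in (src (e k)).2 -> exists n, [/\ (n <= k)%N, (src (e n)).1 = u
    & forall l, (n <= l < k)%N -> ~~ deviation (e l)].
Proof.
move=> init St; elim=> [|k IH] u.
  by rewrite init inE => /eqP->; exists 0%N; rewrite init; split=> // l; lia.
rewrite St /target /=; case: ifP => [/eqP ex|_].
  rewrite !inE => /predU1P[->|/IH[n [nk nu nd]]].
    by exists k.+1; rewrite St; split=> // l; lia.
  exists n; split=> //; first by lia.
  move=> l /andP[nl lk]; have [->|lk'] := eqVneq l k; last by apply: nd; lia.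
  by rewrite /deviation ex eqxx.
by rewrite inE => /eqP->; exists k.+1; rewrite St; split=> // l; lia.
Qed.

(** The weights are the cycle frequencies at one date [M], at which the average of the owner of [v]
    is low and which is late enough for all other estimates. *)
Lemma certificate_approx lam v (al : R) c (d : R) :
  (forall u, lam u != -oo%E) -> (nego lam v <= al%:E)%E ->
  (forall t, c t \in answers (owner v) t) -> 0 < d ->
  exists I e T0 (p : cyc I -> R),
  [/\ arena_play v c I e T0, forall C, 0 <= p C <= 1,
      `|mean p (fun=> 1) - 1| <= d, mean p (step_reward (owner v)) <= al + d
    & forall u, claims I u ->
        exists2 x, lam u = x%:E & x - d <= mean p (step_reward (owner u))].
Proof.
(* One third each for the infimum in [nego], the limit inferior and the cycle decomposition. *)
move=> lamNy nego_le cA d0; pose d' := d / 3.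
have d'0 : 0 < d' by rewrite /d'; lra.
have : (nego lam v < (al + d')%:E)%E.
  by apply: le_lt_trans nego_le _; rewrite lte_fin; lra.
move=> /ereal_inf_lt[_ [tau Hrat <-] Hsup].
have [e [init He [s sS out] cons]] := play_of_rational Hrat cA.
have St n : src (e n.+1) = tgt (e n) by case: (He n).
have [I [T0 [tail inf]]] := inf_often_set e.
have play : arena_play v c I e T0.
  by split=> // n; case: (He n).
have mpE j n : mean_payoff j (fun k => (src (e (n + k)%N)).1) =
    avg_liminf (fun k => step_reward j (e (n + k)%N)).
  congr limn_einf; apply: funext => M; congr (_ / _)%:E.
  by apply: eq_bigr => k _; rewrite /step_reward addnS St.
have low u : exists N : nat, forall M, (N < M)%N -> claims I u ->
    exists2 x, lam u = x%:E & (x - d') * M%:R <= \sum_(k < M) step_reward (owner u) (e k).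
  have [/andP[/forall_inP nodev /exists_inP[t tI ut]]|ncl] := boolP (claims I u); last first.
    by exists 0%N => M _.
  have [k Tk ek] := inf t tI T0; rewrite -ek in ut.
  have [n [nk nu nd]] := visited_since init St ut.
  have nd' l : (n <= l)%N -> ~~ deviation (e l).
    move=> nl; have [lk|kl] := ltnP l k; first by apply: nd; rewrite nl.
    by apply: nodev; apply: tail; lia.
  have := cons n nd' n (leqnn n); rewrite nu mpE => lam_le.
  case lamu: (lam u) (lamNy u) lam_le => [x| |] // _ lam_le.
    have [N HN] := avg_liminf_tail_ge (f := fun k => step_reward (owner u) (e k)) lam_le d'0.
    by exists N => M NM _; exists x => //; apply: HN.
  have [B HB] := mean_payoff_bounded (owner u).
  have /andP[_] := HB (fun k => (src (e (n + k)%N)).1).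
  by rewrite mpE => /(le_trans lam_le).
have err (g : step -> R) : exists N : nat, forall M, (N < M)%N ->
    (\sum_x `|g x|) * (T0 + #|position G|)%:R <= d' * M%:R.
  exact: small_for_large.
have [N1 HN1] := finite_eventually low.
have [N2 HN2] := finite_eventually (fun u => err (step_reward (owner u))).
have [N3 HN3] := err (fun=> 1).
have [N4 HN4] := err (step_reward (owner v)).
have mp_le : (avg_liminf (fun k => step_reward (owner v) (e (0 + k)%N)) <= (al + d')%:E)%E.
  rewrite -mpE; apply: le_trans (ltW Hsup); apply: ereal_sup_ubound.
  by exists s => //; rewrite out.
have [M NM HM] := avg_liminf_leP mp_le d'0 (N1 + N2 + N3 + N4 + T0)%N.
have [M1 M2 M3 M4 MT] : [/\ N1 < M, N2 < M, N3 < M, N4 < M & T0 < M]%N.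
  by move: NM; clear; split; lia.
have M_gt0 : (0 < M)%N := leq_ltn_trans (leq0n _) MT.
have M0 : 0 < M%:R :> R by rewrite ltr0n.
have [p [p01 Hp]] := cycle_frequencies R St tail M_gt0 (ltnW MT).
exists I, e, T0, p; split=> //.
- have := Hp (fun=> 1); rewrite sumr_const card_ord divff ?gt_eqF // => /le_trans; apply.
  rewrite ler_pdivrMr //; apply: le_trans (HN3 M M3) _.
  by rewrite ler_pM2r // /d'; lra.
- have := Hp (step_reward (owner v)); rewrite ler_norml => /andP[_].
  have : (\sum_x `|step_reward (owner v) x|) * (T0 + #|position G|)%:R / M%:R <= d'.
    by rewrite ler_pdivrMr // HN4.
  have : (\sum_(k < M) step_reward (owner v) (e k)) / M%:R <= al + d' + d'.
    by rewrite ler_pdivrMr.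
  by rewrite /d'; lra.
- move=> u clu; have [x lamx Hx] := HN1 u M M1 clu; exists x => //.
  have := Hp (step_reward (owner u)); rewrite ler_norml => /andP[+ _].
  have : (\sum_x `|step_reward (owner u) x|) * (T0 + #|position G|)%:R / M%:R <= d'.
    by rewrite ler_pdivrMr // HN2.
  have : x - d' <= (\sum_(k < M) step_reward (owner u) (e k)) / M%:R.
    by rewrite ler_pdivlMr.
  by clear lamx; rewrite /d'; lra.
Qed.

(** Pigeonhole fixes [I] for all precisions, then the weights pass to the limit by
    [linear_system_closed]. The converse is [certificates_nego]. *)
Lemma certificate_exists lam v (al : R) c :
  (forall u, lam u != -oo%E) -> (nego lam v <= al%:E)%E ->
  (forall t, c t \in answers (owner v) t) ->
  exists I e T0 (p : cyc I -> R), arena_play v c I e T0 /\ certifies lam v al p.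
Proof.
move=> lamNy nego_le cA.
pose P d I := exists e T0 (p : cyc I -> R),
  [/\ arena_play v c I e T0, forall C, 0 <= p C <= 1,
      `|mean p (fun=> 1) - 1| <= d, mean p (step_reward (owner v)) <= al + d
    & forall u, claims I u ->
        exists2 x, lam u = x%:E & x - d <= mean p (step_reward (owner u))].
have [|d d0|I HI] := @finite_pigeonhole R {set step} P.
- move=> d d' I [e [T0 [p [play p01 p1 pup plow]]]] dd'; exists e, T0, p; split=> //.
  + exact: le_trans dd'.
  + by apply: le_trans pup _; rewrite lerD2l.
  + move=> u /plow[x lamx xle]; exists x => //; apply: le_trans xle.
    by rewrite lerD2l lerN2.
- by have [I H] := certificate_approx lamNy nego_le cA d0; exists I.
(* The play may be taken at precision 1, since the type of the weights depends only on [I]. In the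
   system below, the equation of total weight 1 is split into two inequalities. *)
have [e [T0 [p0 [play _ _ _ fin]]]] := HI 1 ltr01.
pose a (j : V + option bool) (C : cyc I) : R := match j with
  | inl u => if claims I u then - weight (step_reward (owner u)) C else 0
  | inr (Some true) => weight (fun=> 1) C
  | inr (Some false) => - weight (fun=> 1) C
  | inr None => weight (step_reward (owner v)) C end.
pose b (j : V + option bool) : R := match j with
  | inl u => if claims I u then - fine (lam u) else 0
  | inr (Some true) => 1
  | inr (Some false) => -1
  | inr None => al end.
have [|p [p01 Hp]] := @linear_system_closed R (cyc I) (V + option bool)%type a b.
  move=> d d0; have [_ [_ [p [_ p01 p1 pup plow]]]] := HI d d0.
  exists p; split=> // -[u|[[]|]] /=; move: p1; rewrite ler_norml => /andP[p1 p2].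
  - case: ifP => [clu|_]; last by rewrite big1 ?add0r ?ltW // => C _; rewrite mulr0.
    have [x lamx] := plow u clu; rewrite lamx /= /mean => H.
    under eq_bigr do rewrite mulrN.
    by rewrite sumrN; clear lamx; lra.
  - by move: p2; rewrite /mean; lra.
  - under eq_bigr do rewrite mulrN.
    by move: p1; rewrite sumrN /mean; lra.
  - exact: pup.
exists I, e, T0, p; split=> //; split.
- by move=> C; case/andP: (p01 C).
- have h1 := Hp (inr (Some true)); have := Hp (inr (Some false)); move: h1.
  rewrite /= -/(mean p (fun=> 1)); under [X in _ -> X <= _ -> _]eq_bigr do rewrite mulrN.
  by rewrite sumrN -/(mean p (fun=> 1)) lerN2 => h1 h2; apply/le_anti; rewrite h1.
- exact: (Hp (inr None)).
- move=> u clu; have [x lamx _] := fin u clu; exists x => //.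
  have := Hp (inl u); rewrite /= clu lamx /=.
  by under eq_bigr do rewrite mulrN; rewrite sumrN lerN2.
Qed.

Lemma certificates_nego lam v (al : R) :
  (forall c : {ffun position G * V -> V}, (forall t, c t \in answers (owner v) t) ->
    exists I e T0 (p : cyc I -> R), arena_play v c I e T0 /\ certifies lam v al p) ->
  (nego lam v <= al%:E)%E.
Proof.
move=> H.
have [|s|c cA|S [m [l val win]]] := @wins_positional R _ _ (@proposal_legal G)
    (@next_position G) (good_steps lam (owner v) al) _ (answers (owner v)) (v, [set v]).
- exact: good_steps_perm.
- rewrite /answers; case: ifP => _; last by apply/finset.set0Pn; exists s.2; rewrite inE.
  by have [w sw] := edge_total s.1.1; apply/finset.set0Pn; exists w; rewrite inE.
- by have [I [e [T0 [p [play cert]]]]] := H c cA; apply: certificate_wins play cert.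
exact: nego_le_arena l val win.
Qed.

End Certificates.

(** * Perturbation of the least fixed point *)

Lemma sum_option (K : realType) (T : finType) (F : option T -> K) :
  \sum_o F o = F None + \sum_t F (Some t).
Proof.
rewrite (bigD1 None) //=; congr (_ + _).
rewrite (reindex_omap Some id) /=; last by case.
by apply: eq_bigl => t; rewrite eqxx.
Qed.

Section Perturbation.

Variable G : mpgame.
Local Notation V := (vertex G).
Local Notation step := (position G * V * V)%type.
Local Notation tgt := (target (@next_position G)).
Local Notation src := (@source (position G) V).
Local Notation cyc I := (cycle_in src tgt I).
Implicit Type lam : requirement G.

(** Rationality covers the history reduced to [v]. For [0 <= eps], a shifted requirement therefore
    meets the lower inequality of a fixed point automatically. *)
Lemma nego_ge lam v : (lam v <= nego lam v)%E.
Proof.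
apply: le_ereal_inf_tmp => _ [tau [tauS [s [sS sC]]] <-].
apply: le_trans (_ : (mean_payoff (owner v) (outcome (upd tau (owner v) s) [::] v) <= _)%E);
  last by apply: ereal_sup_ubound; exists s.
have := sC [::] v _ 0%N; apply.
by exists [::]; split=> //; split=> // -[].
Qed.

Lemma nego_neqNy lam v : nego lam v != -oo%E.
Proof.
have [B HB] := mean_payoff_bounded (owner v).
suff : ((- B)%:E <= nego lam v)%E by case: (nego lam v).
apply: le_ereal_inf_tmp => _ [tau _ <-].
pose s : strat G := fun h => some_succ (last v h).
have sS : is_strat (owner v) s.
  by move=> h w _; rewrite /s last_rcons; apply: (xchooseP (@edge_total G w)).
apply: le_trans (_ : (mean_payoff (owner v) (outcome (upd tau (owner v) s) [::] v) <= _)%E);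
  last by apply: ereal_sup_ubound; exists s.
by case/andP: (HB (outcome (upd tau (owner v) s) [::] v)).
Qed.

Lemma eps_fixed_point_neqNy eps lam : eps_fixed_point eps lam ->
  forall v, lam v != -oo%E.
Proof.
move=> fp v; have /andP[_] := fp v; have := nego_neqNy lam v.
by case: (lam v) => // nN; rewrite leeNy_eq (negbTE nN).
Qed.

Definition shift lam (d : V -> R) (t : R) : requirement G :=
  fun u => (lam u + (t * d u)%:E)%E.

Variables (eps : rat) (D : nat) (Rm : R).
Hypothesis Rm1 : 1 <= Rm.
Hypothesis D_pos : (0 < D)%N.
Hypothesis D_le : D%:R <= Rm.
Hypothesis D_eps : (D%:R * ratr eps : R) \is a Num.int /\ `|D%:R * ratr eps : R| <= Rm.
Hypothesis D_reward : forall j a b, @edge G a b ->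
  (D%:R * ratr (reward j a b) : R) \is a Num.int /\
  `|D%:R * ratr (reward j a b) : R| <= Rm.

Definition row_bound : R := #|position G|%:R * Rm.

(** The rows are the total weight, the bound for the owner and one requirement per vertex, hence
    [|V| + 2], and the last factor bounds the separating vector. Clearing denominators costs [Rm];
    the factor 3 leaves room for the two terms that may meet in one coefficient. *)
Definition eq_bound : R :=
  3 * Rm * ((#|V|.+2)`!%:R * row_bound ^+ #|V|.+2).

Lemma play_edge v c I e T0 t : arena_play v c I e T0 ->
  (forall s, c s \in answers (owner v) s) -> t \in I -> @edge G t.1.1.1 t.2.
Proof.
move=> [_ legal answ _ _ inf] cA tI; have [k _ <-] := inf t tI 0%N.
have := cA (e k).1; rewrite -answ /answers; case: ifP => _; rewrite inE // => /eqP->.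
exact: legal.
Qed.

Lemma weight_bound v c I e T0 j (C : cyc I) : arena_play v c I e T0 ->
  (forall s, c s \in answers (owner v) s) ->
  D%:R * weight (step_reward j) C \is a Num.int /\
  `|D%:R * weight (step_reward j) C| <= row_bound.
Proof.
move=> play cA; rewrite /weight mulr_sumr.
have CI t : t \in bseqval (val C) -> t \in I.
  by case/andP: (valP C) => _ /allP; apply.
have tB t : t \in bseqval (val C) -> D%:R * step_reward j t \is a Num.int /\
    `|D%:R * step_reward j t| <= Rm.
  by move=> /CI tI; apply: D_reward; apply: play_edge play cA tI.
split; first by rewrite big_seq; apply: rpred_sum => t /tB[].
apply: le_trans (ler_norm_sum _ _ _) _.
apply: (@le_trans _ _ (\sum_(t <- bseqval (val C)) Rm)).
  by rewrite big_seq [leRHS]big_seq; apply: ler_sum => t /tB[].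
rewrite big_const_seq iter_addr_0 count_predT -mulr_natl ler_wpM2r //.
  by apply: le_trans Rm1.
by rewrite ler_nat size_bseq.
Qed.

Lemma weight1_bound I (C : cyc I) :
  weight (fun=> 1 : R) C \is a Num.int /\ `|weight (fun=> 1 : R) C| <= row_bound.
Proof.
rewrite /weight big_const_seq iter_addr_0 count_predT; split=> //.
rewrite normr_nat /row_bound.
apply: (@le_trans _ _ #|position G|%:R); first by rewrite ler_nat size_bseq.
by rewrite ler_peMr.
Qed.

(** * Moving along a direction that respects every small equation *)

Section Shift.
Variables (lam : requirement G) (d : V -> R).
Hypothesis d_eq : forall (a : V -> R) (c : R),
  (forall t, a t \is a Num.int /\ `|a t| <= eq_bound) ->
  c \is a Num.int -> `|c| <= eq_bound -> \sum_t a t * fine (lam t) = c ->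
  \sum_t a t * d t = 0.

Lemma row_bound_ge1 (v : V) : 1 <= row_bound.
Proof.
rewrite /row_bound mulr_ege1 //.
by rewrite ler1n; apply/card_gt0P; exists (v, finset.set0).
Qed.

(** If no such [q] existed, a separating vector, paired with [p], would yield a small integer
    equation that [lam] satisfies and [d] violates, against [d_eq]. *)
Lemma direction_exists v c I e T0 (p : cyc I -> R) x :
  arena_play v c I e T0 -> (forall s, c s \in answers (owner v) s) ->
  lam v = x%:E -> certifies lam v (x + ratr eps) p ->
  exists q : cyc I -> R,
  [/\ forall C, p C = 0 -> q C = 0, mean q (fun=> 1) = 0,
      mean p (step_reward (owner v)) = x + ratr eps ->
        mean q (step_reward (owner v)) = d v
    & forall u, claims I u -> mean p (step_reward (owner u)) = fine (lam u) ->
        mean q (step_reward (owner u)) = d u].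
Proof.
move=> play cA lamx [p0 p1 pup plow].
pose ta := mean p (step_reward (owner v)) == x + ratr eps.
pose tu u := claims I u && (mean p (step_reward (owner u)) == fine (lam u)).
pose B0 (j : option (option V)) (C : cyc I) : R := match j with
  | None => weight (fun=> 1) C
  | Some None => if ta then D%:R * weight (step_reward (owner v)) C else 0
  | Some (Some u) => if tu u then D%:R * weight (step_reward (owner u)) C else 0 end.
(* Erasing the columns outside the support of [p] lets [q] vanish there. *)
pose B j C := if p C == 0 then 0 else B0 j C.
pose w (j : option (option V)) : R := match j with
  | None => 0
  | Some None => if ta then D%:R * d v else 0
  | Some (Some u) => if tu u then D%:R * d u else 0 end.
have rb1 := row_bound_ge1 v.
have D0 : D%:R != 0 :> R by rewrite pnatr_eq0 -lt0n.
have Rm0 : 0 <= Rm by apply: le_trans Rm1.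
have B_small j C : B j C \is a Num.int /\ `|B j C| <= row_bound.
  rewrite /B; case: ifP => _; first by rewrite rpred0 normr0; split=> //; lra.
  case: j => [[u|]|] /=; last exact: weight1_bound.
  - case: ifP => _; first exact: weight_bound play cA.
    by rewrite rpred0 normr0; split=> //; lra.
  - case: ifP => _; first exact: weight_bound play cA.
    by rewrite rpred0 normr0; split=> //; lra.
have [[q Hq]|[y [ys yB yw]]] := small_separating_fin w rb1 B_small.
  pose q' C := if p C == 0 then 0 else q C.
  have mean_q' g : mean q' g = \sum_C q C * (if p C == 0 then 0 else weight g C).
    by apply: eq_bigr => C _; rewrite /q'; case: ifP => _; rewrite ?mul0r ?mulr0.
  exists q'; split.
  - by move=> C pC; rewrite /q' pC eqxx.
  - by rewrite mean_q'; exact: (Hq None).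
  - move=> /eqP tight; apply: (mulfI D0); have := Hq (Some None).
    rewrite /w /B /B0 /ta tight => <-; rewrite mean_q' mulr_sumr.
    by apply: eq_bigr => C _; case: ifP => _; rewrite ?mulr0 // mulrCA.
  - move=> u clu /eqP tight; apply: (mulfI D0); have := Hq (Some (Some u)).
    rewrite /w /B /B0 /tu clu tight /= => <-; rewrite mean_q' mulr_sumr.
    by apply: eq_bigr => C _; case: ifP => _; rewrite ?mulr0 // mulrCA.
exfalso; case/eqP: yw.
pose Yb : R := (#|V|.+2)`!%:R * row_bound ^+ #|V|.+2.
have Yb0 : 0 <= Yb by rewrite mulr_ge0 // exprn_ge0 //; lra.
have card_J : #|{: option (option V)}| = #|V|.+2 by rewrite !card_option.
have {}ys j : y j \is a Num.int /\ `|y j| <= Yb.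
  by have := ys j; rewrite card_J.
(* The vertex [v] may occur twice: as the value that bounds its owner from above, whose [eps] goes
   into [cst], and as a requirement. *)
pose a u : R := (if (u == v) && ta then D%:R * y (Some None) else 0) +
  (if tu u then D%:R * y (Some (Some u)) else 0).
pose cst : R := - (y None + (if ta then y (Some None) * (D%:R * ratr eps) else 0)).
have sum_a (f : V -> R) : \sum_u a u * f u =
    (if ta then y (Some None) * (D%:R * f v) else 0) +
    \sum_u (if tu u then y (Some (Some u)) * (D%:R * f u) else 0).
  under eq_bigr do rewrite /a mulrDl.
  rewrite big_split /=; congr (_ + _); last first.
    by apply: eq_bigr => u _; case: ifP => _; [ring|rewrite mul0r].
  rewrite (bigD1 v) //= eqxx /= big1 ?addr0; last first.
    by move=> u /negbTE->; rewrite mul0r.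
  by case: ifP => _; [ring|rewrite mul0r].
have sum_w : \sum_j y j * w j = \sum_u a u * d u.
  rewrite sum_option sum_option sum_a /= mulr0 add0r; congr (_ + _).
    by case: ifP => _; rewrite ?mulr0.
  by apply: eq_bigr => u _; case: ifP => _; rewrite ?mulr0.
have Dint : (D%:R : R) \is a Num.int by [].
have Dn : `|D%:R : R| <= Rm by rewrite normr_nat.
rewrite sum_w; apply: (d_eq (c := cst)).
- move=> u; have [ia ba] := ys (Some None); have [iu bu] := ys (Some (Some u)).
  have ifB (b : bool) (z : R) : z \is a Num.int -> `|z| <= Yb ->
      (if b then D%:R * z else 0) \is a Num.int /\ `|if b then D%:R * z else 0| <= Rm * Yb.
    case: b => iz bz; last by rewrite rpred0 normr0; split=> //; rewrite mulr_ge0.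
    by rewrite rpredM // normrM; split=> //; apply: ler_pM.
  have [i1 b1] := ifB ((u == v) && ta) _ ia ba; have [i2 b2] := ifB (tu u) _ iu bu.
  rewrite /a rpredD //; split=> //; apply: le_trans (ler_normD _ _) _.
  have : 0 <= Rm * Yb by rewrite mulr_ge0.
  rewrite /eq_bound -/Yb; lra.
- have [ia _] := ys (Some None); have [i0 _] := ys None; have [ie _] := D_eps.
  by rewrite /cst rpredN rpredD //; case: ifP => _; rewrite ?rpred0 // rpredM.
- have [_ ba] := ys (Some None); have [_ b0] := ys None; have [_ be] := D_eps.
  rewrite /cst normrN; apply: le_trans (ler_normD _ _) _.
  have h : `|if ta then y (Some None) * (D%:R * ratr eps) else 0| <= Yb * Rm.
    case: ifP => _; last by rewrite normr0 mulr_ge0.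
    by rewrite normrM; apply: ler_pM.
  have : Yb <= Rm * Yb by rewrite ler_peMl.
  have : 0 <= Rm * Yb by rewrite mulr_ge0.
  rewrite /eq_bound -/Yb; lra.
(* Pairing [y B = 0] with [p] turns the tight constraints into one equation
   between the finite values of [lam]. *)
have BpE j : \sum_C B j C * p C = \sum_C B0 j C * p C.
  by apply: eq_bigr => C _; rewrite /B; case: eqP => // ->; rewrite !mulr0.
have yBp : \sum_j y j * (\sum_C B0 j C * p C) = 0.
  under eq_bigr do rewrite -BpE mulr_sumr.
  rewrite exchange_big /= big1 // => C _.
  by under eq_bigr do rewrite mulrA; rewrite -mulr_suml yB mul0r.
have B0a : \sum_C B0 (Some None) C * p C = if ta then D%:R * (x + ratr eps) else 0.
  rewrite /B0; case: ifP => tat; last by rewrite big1 // => C _; rewrite mul0r.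
  rewrite -(eqP tat) /mean mulr_sumr; apply: eq_bigr => C _; ring.
have B0u u : \sum_C B0 (Some (Some u)) C * p C = if tu u then D%:R * fine (lam u) else 0.
  rewrite /B0; case: ifP => tut; last by rewrite big1 // => C _; rewrite mul0r.
  case/andP: tut => _ /eqP <-; rewrite /mean mulr_sumr; apply: eq_bigr => C _; ring.
have B01 : \sum_C B0 None C * p C = 1.
  by rewrite -p1 /mean; apply: eq_bigr => C _; rewrite mulrC.
move: yBp; rewrite sum_option sum_option B01 B0a.
under eq_bigr do rewrite B0u.
rewrite sum_a lamx /= /cst => e1.
have -> : \sum_u (if tu u then y (Some (Some u)) * (D%:R * fine (lam u)) else 0) =
   \sum_u y (Some (Some u)) * (if tu u then D%:R * fine (lam u) else 0).
  by apply: eq_bigr => u _; case: ifP => _; rewrite ?mulr0.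
by move: e1; clear lamx; case: (ta); lra.
Qed.

Lemma mean_shift I (p q : cyc I -> R) t g :
  mean (fun C => p C + t * q C) g = mean p g + t * mean q g.
Proof.
by rewrite /mean mulr_sumr -big_split /=; apply: eq_bigr => C _; ring.
Qed.

(** Along [q] the tight constraints stay tight, and those with slack survive for small [t] of either
    sign. *)
Lemma shift_certifies v c I e T0 (p : cyc I -> R) x :
  arena_play v c I e T0 -> (forall s, c s \in answers (owner v) s) ->
  lam v = x%:E -> certifies lam v (x + ratr eps) p ->
  exists2 t0, 0 < t0 & forall t, `|t| <= t0 ->
    exists p' : cyc I -> R, certifies (shift lam d t) v (x + t * d v + ratr eps) p'.
Proof.
move=> play cA lamx cert; have [q [q0 q1 qa qu]] := direction_exists play cA lamx cert.
move: cert => [p0 p1 pup plow].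
have [tp tp0 Hp] : exists2 t0 : R, 0 < t0 & forall t, `|t| <= t0 ->
    forall C, 0 <= p C + t * q C.
  apply: small_for_all => C; have [pC|pC] := eqVneq (p C) 0.
    by exists 1 => // t _; rewrite pC q0 // mulr0 addr0.
  by apply: small_affine; rewrite lt_def pC p0.
have [ta ta0 Ha] : exists2 t0 : R, 0 < t0 & forall t, `|t| <= t0 ->
    mean p (step_reward (owner v)) + t * mean q (step_reward (owner v)) <=
    x + t * d v + ratr eps.
  have [tight|ntight] := eqVneq (mean p (step_reward (owner v))) (x + ratr eps).
    by exists 1 => // t _; rewrite qa // tight addrAC.
  have [|t0 t00 H] := @small_affine R
      (x + ratr eps - mean p (step_reward (owner v)))
      (d v - mean q (step_reward (owner v))).
    by rewrite subr_gt0 lt_neqAle ntight.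
  by exists t0 => // t /H; clear lamx; lra.
have [tu tu0 Hu] : exists2 t0 : R, 0 < t0 & forall t, `|t| <= t0 ->
    forall u, claims I u -> fine (lam u) + t * d u <=
    mean p (step_reward (owner u)) + t * mean q (step_reward (owner u)).
  apply: small_for_all => u; have [clu|ncl] := boolP (claims I u); last by exists 1.
  have [tight|ntight] := eqVneq (mean p (step_reward (owner u))) (fine (lam u)).
    by exists 1 => // t _ _; rewrite qu // tight.
  have [|t0 t00 H] := @small_affine R
      (mean p (step_reward (owner u)) - fine (lam u))
      (mean q (step_reward (owner u)) - d u).
    rewrite subr_gt0 lt_neqAle eq_sym ntight /=.
    by have [y lamy] := plow u clu; rewrite lamy.
  by exists t0 => // t /H + _; clear lamx; lra.
exists (Num.min tp (Num.min ta tu)); first by rewrite !lt_min tp0 ta0 tu0.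
move=> t; rewrite !le_min => /and3P[/Hp hp /Ha ha /Hu hu].
exists (fun C => p C + t * q C); split=> //.
- by rewrite mean_shift q1 p1 mulr0 addr0.
- by rewrite mean_shift.
- move=> u clu; exists (fine (lam u) + t * d u); last by rewrite mean_shift hu.
  by have [y lamy _] := plow u clu; rewrite /shift lamy.
Qed.

(** One certificate is perturbed for each vertex and positional strategy; there are finitely many,
    so a common [t0] exists. *)
Lemma shift_fixed_point : 0 <= eps -> eps_fixed_point eps lam ->
  exists2 t0, 0 < t0 & forall t, `|t| <= t0 -> eps_fixed_point eps (shift lam d t).
Proof.
move=> eps0 fp; have lamNy := eps_fixed_point_neqNy fp.
pose P (k : V * {ffun position G * V -> V}) (t : R) :=
  forall x, lam k.1 = x%:E -> (forall s, k.2 s \in answers (owner k.1) s) ->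
  exists I e T0 (p : cyc I -> R), arena_play k.1 k.2 I e T0 /\
    certifies (shift lam d t) k.1 (x + t * d k.1 + ratr eps) p.
have [|t0 t00 H] := @small_for_all R _ P.
  move=> [v c]; rewrite /P /=.
  have [finv|ninf] := boolP (lam v \is a fin_num); last first.
    by exists 1 => // t _ x lamx; rewrite lamx in ninf.
  have [cA|ncA] := pselect (forall s, c s \in answers (owner v) s); last first.
    by exists 1.
  case lamx: (lam v) finv => [x| |] // _.
  have nego_le : (nego lam v <= (x + ratr eps)%:E)%E.
    by have /andP[_] := fp v; rewrite lamx.
  have [I [e [T0 [p [play cert]]]]] := certificate_exists lamNy nego_le cA.
  have [t0 t00 H] := shift_certifies play cA lamx cert.
  exists t0 => // t /H[p' cert'] y [<-] _; exists I, e, T0, p'; split=> //.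
exists t0 => // t tle v; apply/andP; split.
  apply: le_trans (nego_ge _ _); rewrite leeBlDr // leeDl // lee_fin.
  by rewrite ler0q.
have := H t tle; rewrite /P => {}H.
case lamx: (lam v) (lamNy v) => [x| |] // _; last first.
  by rewrite /shift lamx /= leey.
rewrite /shift lamx -!EFinD; apply: certificates_nego => c cA.
exact: (H (v, c) x lamx cA).
Qed.

End Shift.

Theorem least_fixed_point_rational lam : 0 <= eps -> least_eps_fixed_point eps lam ->
  forall v, exists z1 z2 : R,
  [/\ z1 \is a Num.int /\ `|z1| <= (#|V|)`!%:R * eq_bound ^+ #|V|,
      z2 \is a Num.int /\ `|z2| <= (#|V|)`!%:R * eq_bound ^+ #|V|, z2 != 0
    & fine (lam v) = z1 / z2].
Proof.
move=> eps0 [fp least] v; have rb1 := row_bound_ge1 v.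
have eb1 : 1 <= eq_bound.
  have h1 : 1 <= 3 * Rm by move: Rm1; lra.
  have h2 : 1 <= (#|V|.+2)`!%:R * row_bound ^+ #|V|.+2.
    by rewrite mulr_ege1 // ?ler1n ?fact_gt0 // exprn_ege1.
  by rewrite /eq_bound mulr_ege1.
apply: (cramer_small_fin (x := fun u => fine (lam u))) => // d d_eq {v rb1} v.
(* [fine] sends an infinite value to 0, so [fine (lam u) = 0] is itself a small equation and forces
   [d u = 0]. *)
have d_inf u : lam u \isn't a fin_num -> d u = 0.
  move=> ninf; have := d_eq (fun u' => (u' == u)%:R) 0.
  have single (f : V -> R) : \sum_u' (u' == u)%:R * f u' = f u.
    rewrite (bigD1 u) //= eqxx mul1r big1 ?addr0 // => u' /negbTE->.
    by rewrite mul0r.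
  rewrite !single; apply.
  - move=> u'; split; first by case: eqP.
    by case: eqP => _; rewrite ?normr1 ?normr0 //; lra.
  - by rewrite rpred0.
  - by rewrite normr0; lra.
  - by case: (lam u) ninf.
have [t0 t00 H] := shift_fixed_point d_eq eps0 fp.
have [finv|/d_inf//] := boolP (lam v \is a fin_num).
have n1 : `|t0| <= t0 by rewrite ger0_norm // ltW.
have n2 : `|- t0| <= t0 by rewrite normrN.
have h1 := least _ (H _ n1) v; have h2 := least _ (H _ n2) v.
move: h1 h2; rewrite /shift; case: (lam v) finv => // x _.
rewrite -!EFinD !lee_fin => h1 h2; apply/eqP; rewrite eq_le.
by rewrite -(pmulr_rle0 _ t00) -(pmulr_rge0 _ t00); lra.
Qed.

End Perturbation.

(** * Sizes *)

Lemma size_rat_num (q : rat) : (`|numq q| <= 2 ^ size_rat q)%N.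
Proof.
apply: (@leq_trans (`|numq q| + 1)); first by rewrite leq_addr.
apply: leq_trans (up_logP _ (ltnSn 1)) _.
by rewrite leq_exp2l // /size_rat; lia.
Qed.

Lemma size_rat_den (q : rat) : (`|denq q| <= 2 ^ size_rat q)%N.
Proof.
apply: (@leq_trans (`|denq q| + 1)); first by rewrite leq_addr.
apply: leq_trans (up_logP _ (ltnSn 1)) _.
by rewrite leq_exp2l // /size_rat; lia.
Qed.

Lemma size_rat_le (q : rat) F : (`|numq q| <= 2 ^ F)%N -> (`|denq q| <= 2 ^ F)%N ->
  (size_rat q <= 2 * F + 3)%N.
Proof.
have up n : (n <= 2 ^ F)%N -> (up_log 2 (n + 1) <= F.+1)%N.
  move=> h; apply: up_log_min => //; rewrite expnS mul2n -addnn.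
  by rewrite leq_add // expn_gt0.
by move=> /up h1 /up h2; rewrite /size_rat; lia.
Qed.

Lemma fact_le_pow n : (n`! <= 2 ^ (n * n))%N.
Proof.
elim: n => // n IH; rewrite factS.
apply: (@leq_trans (2 ^ n.+1 * 2 ^ (n * n))); first by apply: leq_mul => //; apply/ltnW/ltn_expl.
by rewrite -expnD leq_exp2l //; lia.
Qed.

Lemma den_mul_int (D : nat) (q : rat) : (`|denq q| %| D)%N ->
  (D%:R * ratr q : R) \is a Num.int /\ `|D%:R * ratr q : R| <= (D * `|numq q|)%:R.
Proof.
move=> /dvdnP[k ->].
have dR : `|denq q|%:R = (denq q)%:~R :> R.
  by rewrite pmulrn gez0_abs // ltW // denq_gt0.
have e : ((k * `|denq q|)%:R * ratr q : R) = k%:R * (numq q)%:~R.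
  rewrite natrM dR -mulrA; congr (_ * _).
  have d0 : (denq q)%:~R != 0 :> R by rewrite intr_eq0 denq_neq0.
  by rewrite /ratr mulrCA divff // mulr1.
rewrite e; split; first by rewrite rpredM ?rpred_nat ?rpred_int.
rewrite normrM normr_nat natrM natrM -mulrA ler_wpM2l //.
rewrite -intr_norm -abszE -pmulrn ler_peMl // ler1n.
by rewrite absz_gt0 denq_neq0.
Qed.

Section Sizes.

Variables (G : mpgame) (eps : rat).
Local Notation V := (vertex G).

Definition total_size : nat := (game_size G + size_rat eps)%N.
Local Notation s := total_size.

(** A plain product is small enough, because the size of the game already adds up the bit lengths of
    the rewards. *)
Definition common_den : nat :=
  ((\prod_(i : player G) \prod_(u : V) \prod_(w : V | @edge G u w)
     `|denq (reward i u w)|) * `|denq eps|)%N.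

Lemma common_den_le : (common_den <= 2 ^ s)%N.
Proof.
rewrite /s /game_size expnD; apply: leq_mul; last exact: size_rat_den.
rewrite expnD; apply: leq_trans (leq_pmull _ _); last by rewrite expn_gt0.
rewrite expn_sum; apply: leq_prod => i _.
rewrite expn_sum; apply: leq_prod => u _.
rewrite expn_sum; apply: leq_prod => w _.
exact: size_rat_den.
Qed.

Lemma common_den_gt0 : (0 < common_den)%N.
Proof.
rewrite muln_gt0 absz_gt0 denq_neq0 andbT.
do 3 (apply: prodn_cond_gt0 => ? ?).
by rewrite absz_gt0 denq_neq0.
Qed.

Lemma den_dvd_common i u w : @edge G u w -> (`|denq (reward i u w)| %| common_den)%N.
Proof.
move=> uw; apply: dvdn_mulr.
by rewrite (bigD1 i) //= (bigD1 u) //= (bigD1 w) //= -!mulnA dvdn_mulr.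
Qed.

Lemma reward_size_le i u w : @edge G u w -> (size_rat (reward i u w) <= s)%N.
Proof.
move=> uw; rewrite /s /game_size (bigD1 i) //= (bigD1 u) //= (bigD1 w) //=.
lia.
Qed.

Lemma card_vertex_le : (#|V| <= s)%N.
Proof. by rewrite /s /game_size; lia. Qed.

(** The exponent of 2 that bounds [n! eq_bound^n]. Inside the parentheses stand the bits of
    [eq_bound]: 2 for the constant 3, then [Rm], the factorial and the power of [row_bound]. *)
Definition bit_bound (n : nat) : nat :=
  (n * n + (2 + 2 * n + (n + 2) * (n + 2) + 4 * n * (n + 2)) * n)%N.

Lemma least_fixed_point_size (lam : requirement G) v : 0 <= eps -> least_eps_fixed_point eps lam ->
  exists2 k, ext_size (lam v) k & (k <= 2 * bit_bound s + 3)%N.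
Proof.
move=> eps0 lfp.
have lamNy := eps_fixed_point_neqNy lfp.1 v.
(* One factor [2 ^ s] for the common denominator and one for a numerator. *)
pose Rm : R := (2 ^ (2 * s))%:R.
have Rm1 : 1 <= Rm by rewrite ler1n expn_gt0.
have two_s n k : (n <= 2 ^ s)%N -> (k <= 2 ^ s)%N -> (n * k)%:R <= Rm.
  by move=> n2 k2; rewrite /Rm ler_nat mul2n -addnn expnD leq_mul.
have D_le : common_den%:R <= Rm.
  rewrite -[common_den]muln1; apply: two_s; first exact: common_den_le.
  by rewrite expn_gt0.
have D_mul q : (`|denq q| %| common_den)%N -> (size_rat q <= s)%N ->
    (common_den%:R * ratr q : R) \is a Num.int /\ `|common_den%:R * ratr q : R| <= Rm.
  move=> dv sz; have [i1 b1] := den_mul_int dv; split=> //; apply: le_trans b1 _.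
  apply: two_s; first exact: common_den_le.
  by apply: leq_trans (size_rat_num q) _; rewrite leq_exp2l.
have D_eps := D_mul eps (dvdn_mull _ (dvdnn _)) (leq_addl _ _).
have D_rew j a b (ab : @edge G a b) := D_mul _ (den_dvd_common j ab) (reward_size_le j ab).
have [z1 [z2 [[i1 b1] [i2 b2] z20 ez]]] :=
  least_fixed_point_rational Rm1 common_den_gt0 D_le D_eps D_rew eps0 lfp v.
have Vs := card_vertex_le.
(* There are [|V| 2^|V|] positions, which cost [2 s] bits, and [Rm] costs [2 s] more. *)
have row_le : row_bound G Rm <= (2 ^ (4 * s))%:R.
  rewrite /row_bound /Rm -natrM ler_nat card_prod.
  have -> : #|{: {set V}}| = (2 ^ #|V|)%N.
    by have := card_powerset [set: V]; rewrite finset.powersetT !finset.cardsT.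
  have -> n : (4 * n = n + n + 2 * n)%N by clear; lia.
  rewrite 2!expnD !leq_mul ?leq_exp2l //.
  by apply: leq_trans Vs (ltnW (ltn_expl _ _)).
have fact_le n k : (n <= k)%N -> (n`! <= 2 ^ (k * k))%N.
  by move=> nk; apply: leq_trans (leq_fact nk) (fact_le_pow k).
have rb0 : 0 <= row_bound G Rm by rewrite /row_bound mulr_ge0.
have rbX0 n : 0 <= row_bound G Rm ^+ n by rewrite exprn_ge0.
have eb0 : 0 <= eq_bound G Rm.
  by rewrite /eq_bound; apply: mulr_ge0; apply: mulr_ge0.
have h1 : 3 <= (2 ^ 2)%:R :> R by rewrite ler_nat.
have h2 : (#|V|.+2)`!%:R <= (2 ^ ((s + 2) * (s + 2)))%:R :> R.
  by rewrite ler_nat fact_le // addn2 !ltnS.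
have h3 : row_bound G Rm ^+ #|V|.+2 <= (2 ^ (4 * s * (s + 2)))%:R.
  apply: (@le_trans _ _ ((2 ^ (4 * s))%:R ^+ #|V|.+2)).
    by rewrite lerXn2r // ?nnegrE.
  by rewrite -natrX -expnM ler_nat leq_exp2l // leq_mul // addn2 !ltnS.
pose b0 := (2 + 2 * s + (s + 2) * (s + 2) + 4 * s * (s + 2))%N.
have eq_le : eq_bound G Rm <= (2 ^ b0)%:R.
  rewrite /eq_bound /b0 3!expnD natrM natrM natrM -!mulrA -/Rm.
  apply: ler_pM => //; first by do 2 apply: mulr_ge0 => //.
  by apply: ler_pM => //; [apply: mulr_ge0|apply: ler_pM].
have fin_le : (#|V|)`!%:R * eq_bound G Rm ^+ #|V| <= (2 ^ bit_bound s)%:R.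
  rewrite /bit_bound -/b0 expnD natrM; apply: ler_pM => //.
  - by rewrite exprn_ge0.
  - by rewrite ler_nat fact_le.
  apply: (@le_trans _ _ ((2 ^ b0)%:R ^+ #|V|)); first by rewrite lerXn2r // ?nnegrE.
  by rewrite -natrX -expnM ler_nat leq_exp2l // leq_mul.
have [q [eq num den]] := rat_of_quotient i1 i2 z20 (le_trans b1 fin_le) (le_trans b2 fin_le).
case lamx: (lam v) lamNy => [x| |] // _; last first.
  by exists 1%N; [left; split; [left|]|rewrite addn3].
exists (size_rat q); last exact: size_rat_le.
by right; exists q; split=> //; rewrite -eq -ez lamx.
Qed.

End Sizes.

Theorem theorem5 :
  exists P3 : {poly int},
    forall (G : mpgame) (eps : rat), 0 <= eps ->
      forall lam : requirement G, least_eps_fixed_point eps lam ->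
        exists N : nat, req_size_le lam N /\
          (N%:Z <= P3.[(game_size G + size_rat eps)%N%:Z]).
Proof.
exists ('X + 'X * (2%:P * ('X * 'X + (2%:P + 2%:P * 'X + ('X + 2%:P) * ('X + 2%:P)
  + 4%:P * 'X * ('X + 2%:P)) * 'X) + 3%:P)).
move=> G eps eps0 lam lfp; set n := (game_size G + size_rat eps)%N.
exists (n + n * (2 * bit_bound n + 3))%N; split.
  have /choice[k Hk] : forall v, exists k,
      ext_size (lam v) k /\ (k <= 2 * bit_bound n + 3)%N.
    by move=> v; have [k ? ?] := least_fixed_point_size v eps0 lfp; exists k.
  exists k; split; first by move=> v; case: (Hk v).
  have Vn : (#|vertex G| <= n)%N := card_vertex_le G eps.
  apply: leq_add => //; apply: (@leq_trans (\sum_(v : vertex G) (2 * bit_bound n + 3))%N).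
    by apply: leq_sum => v _; case: (Hk v).
  by rewrite sum_nat_const leq_mul2r Vn orbT.
rewrite !hornerE /bit_bound; clearbody n.
by rewrite !(PoszD, PoszM) le_eqVlt; apply/orP; left; apply/eqP; ring.
Qed.
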